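(* Let $a,b\in\mathbb{C}$ with $\mathrm{Re}(a)>1/2$ and $\mathrm{Re}(b)>1/2$, and let $\gamma_a(|w|)=a\,e^{(1-a)|w|^2}$ and $\gamma_b(|w|)=b\,e^{(1-b)|w|^2}$. The operator $T_{\gamma_a}T_{\gamma_b}$ is a Toeplitz operator with radial symbol in $\mathcal{P}$ if and only if $\mathrm{Re}(ab)>1/2$. In the positive case, the symbol is $\gamma_c(|w|)=c\,e^{(1-c)|w|^2}$ with $c=ab$.
   Context: Notation: $\mathbb{N}=\{0,1,2,\dots\}$. Let $d\mu(z)=\frac1\pi e^{-|z|^2}d^2z$ on $\mathbb{C}$ ($d^2z$ is Lebesgue measure). The Segal-Bargmann space $F^2(\mathbb{C},d\mu)$ is the subspace of entire functions in $L^2(\mathbb{C},d\mu)$. Put $u_n(z)=z^n/\sqrt{n!}$. The Bargmann projection $P:L^2(\mathbb{C},d\mu)\to F^2(\mathbb{C},d\mu)$ is $(Pg)(z)=\int_{\mathbb{C}}e^{z\overline w}g(w)\,d\mu(w)$. Toeplitz operator: for a measurable symbol $\varphi$ on $\mathbb{C}$, $T_\varphi\psi=P(\varphi\psi)$ with natural domain $\mathrm{Dom}(T_\varphi)=\{\psi\in F^2(\mathbb{C},d\mu):\varphi\psi\in L^2(\mathbb{C},d\mu)\}$. A radial symbol is one depending only on $|w|$. Class $\mathcal{P}$: the set of radial symbols $\varphi(|w|)$ such that $u_n\in\mathrm{Dom}(T_\varphi)$ for all $n\in\mathbb{N}$.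
   Formalization: ''Is a Toeplitz operator'' is read as agreement with T_φ, φ in P, on the linear span of the u_n (contained in both natural domains); equality of the natural domains is not claimed, and fails e.g. for a=0.6, b=2. *)

(* Defs.v *)
From HB Require Import structures.
From mathcomp Require Import all_boot all_order all_algebra.
From mathcomp Require Import complex.
From mathcomp Require Import all_classical all_reals all_analysis.

Set Implicit Arguments.
Unset Strict Implicit.
Unset Printing Implicit Defensive.

Import Order.TTheory GRing.Theory Num.Theory.
Import numFieldNormedType.Exports.

Local Open Scope classical_set_scope.
Local Open Scope ring_scope.

Section SegalBargmann.
Variable R : realType.
Local Notation C := (complex R).
Local Notation Re := complex.Re.
Local Notation Im := complex.Im.
Local Notation lebesgue2 := (@lebesgue_measure R \x @lebesgue_measure R)%E.

Definition cexp (z : C) : C :=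
  (expR (Re z))%:C%C * Complex (cos (Im z)) (sin (Im z)).

Definition abs2 (z : C) : R := Re z ^+ 2 + Im z ^+ 2.

(* The plane is R * R with its product sigma-algebra, identified with C by
   (x, y) |-> x + iy. *)
Definition toC (p : R * R) : C := Complex p.1 p.2.

(* The density of dmu with respect to Lebesgue measure; every integral against
   dmu below is written as a Lebesgue integral with this weight. *)
Definition gauss (p : R * R) : R := pi^-1 * expR (- abs2 (toC p)).

Definition cmeasurable (f : C -> C) : Prop :=
  measurable_fun [set: R * R] (fun p => Re (f (toC p))) /\
  measurable_fun [set: R * R] (fun p => Im (f (toC p))).

(* Componentwise integral against dmu; meaningful for integrable f. *)
Definition integral_mu (f : C -> C) : C :=
  Complex (\int[lebesgue2]_p (Re (f (toC p)) * gauss p))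
          (\int[lebesgue2]_p (Im (f (toC p)) * gauss p)).

(* Honest functions, not classes modulo null sets. *)
Definition L2 : set (C -> C) := [set f | cmeasurable f /\
  (\int[lebesgue2]_p (abs2 (f (toC p)) * gauss p)%:E < +oo)%E].

(* Complex differentiability everywhere: C^o is C as a normed space over
   itself, so the derivative in the direction 1 is the complex derivative. *)
Definition entire (f : C -> C) : Prop :=
  forall z : C, derivable (f : C^o -> C^o) z 1.

Definition F2 : set (C -> C) := [set f | entire f /\ L2 f].

Definition basis_u (n : nat) (z : C) : C := z ^+ n / (Num.sqrt (n`!%:R : R))%:C%C.

Definition bargmann (g : C -> C) (z : C) : C :=
  integral_mu (fun w => cexp (z * conjc w) * g w).

(* Partially defined operators: the value of [op_fun] is only meaningful on
   [op_dom]. *)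
Record operator := Operator {
  op_dom : set (C -> C);
  op_fun : (C -> C) -> (C -> C) }.

Definition op_comp (A B : operator) : operator :=
  Operator [set psi | op_dom B psi /\ op_dom A (op_fun B psi)]
           (fun psi => op_fun A (op_fun B psi)).

Definition toeplitz (phi : C -> C) : operator :=
  Operator [set psi | F2 psi /\ L2 (fun w => phi w * psi w)]
           (fun psi => bargmann (fun w => phi w * psi w)).

Definition radial (phi : C -> C) : Prop :=
  forall z w : C, `|z| = `|w| -> phi z = phi w.

Definition classP : set (C -> C) := [set phi |
  [/\ cmeasurable phi, radial phi &
      forall n : nat, op_dom (toeplitz phi) (basis_u n)]].

Definition span_u : set (C -> C) := [set psi | exists (n : nat) (c : nat -> C),
  psi = (fun z => \sum_(k < n) c k * basis_u k z)].

(* Unbounded operators are compared on their common dense domain, the linear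
   span of the u_n.  Equality of the natural domains is not required: the
   domain of a product and the domain of the Toeplitz operator that it equals
   on this span differ in general. *)
Definition op_eq_span (A B : operator) : Prop :=
  forall psi, span_u psi ->
    [/\ op_dom A psi, op_dom B psi & forall z, op_fun A psi z = op_fun B psi z].

Definition is_toeplitz_with_symbol (A : operator) (phi : C -> C) : Prop :=
  classP phi /\ op_eq_span A (toeplitz phi).

Definition eq_ae (f g : C -> C) : Prop :=
  {ae lebesgue2, forall p, f (toC p) = g (toC p)}.

Definition gamma (a : C) (w : C) : C := a * cexp ((1 - a) * (abs2 w)%:C%C).

End SegalBargmann.

(* Main.v *)
Require Import Defs.
From HB Require Import structures.
From mathcomp Require Import all_boot all_order all_algebra.
From mathcomp Require Import complex.
From mathcomp Require Import all_classical all_reals all_analysis.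
From mathcomp Require Import measurable_realfun.
From mathcomp Require Import ring lra.
Set Implicit Arguments.
Unset Strict Implicit.
Unset Printing Implicit Defensive.
Import Order.TTheory GRing.Theory Num.Theory.
Import ComplexField.Normc.
Import numFieldNormedType.Exports.
Local Open Scope classical_set_scope.
Local Open Scope ring_scope.

Local Notation Re := complex.Re.
Local Notation Im := complex.Im.
Local Notation "x %:C" := (real_complex _ x) (format "x %:C").

(** Write [t] for the squared modulus of [w] and [c] for [a * b].

    A Toeplitz operator with radial symbol [phi] is diagonal on the monomials:
    in the expansion of the kernel [cexp (z * conjc w)] in powers of [conjc w],
    the rotation invariance of the plane kills every term except the [n]-th, so
    [u_n] is multiplied by [1 / n!] times the integral of [phi t^n] against
    [mu] ([bargmann_radial]).  For [gamma a] this eigenvalue is [a ^- n]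
    ([toeplitz_gamma_span]), hence the product of the two operators has
    eigenvalues [c ^- n].  If [1 / 2 < Re c], then [gamma c] is in the class
    and has these very eigenvalues.

    Conversely, let [phi] be a symbol of the product and let [M_n(s)] be the
    integral of [phi t^n e^(-s t)] against [mu].  The moments [n! c^(-n)] of
    [phi] say that
      [(c + s) M_n(s) = n M_(n-1)(s)],  with [c] added on the right for [n = 0],
    holds at [s = 0] ([moment_rec]).  As [phi] is square integrable, [M_n(s)]
    converges absolutely for [-1/2 < Re s], and expanding [e^(-delta t)] in
    powers of [delta] carries the relation from [s] to [s + delta]; small steps
    then cover the whole half-plane ([moment_rec_propagate]).  This is the
    analytic continuation of [M_0(s) = c / (c + s)], done without ever dividing
    by [c + s], which may vanish.  If [Re c <= 1/2], the point [s = - c + eps] lies in the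
    half-plane and [eps M_0(s) = c], whereas the Cauchy-Schwarz inequality
    bounds [M_0(s)] by a multiple of [eps^(-1/2)]; letting [eps] tend to [0]
    gives [c = 0], which is absurd ([Re_gt_half]).

    For the uniqueness of the symbol, [phi] and [gamma c] have the same [M_0(s)]
    for all real [s >= 0], and a radial function is determined by these Laplace
    integrals ([radial_laplace_ae0]): polynomials in [e^(-s t)] approximate the
    indicator of [t > theta], and the sets [t > theta] generate the radial Borel
    sets.

    The same propagation, started from the real Gaussian moments
    ([gauss_momentE]), computes the moments of [gamma a] for complex [a]
    ([moment_rec_gamma]). *)

(** * The complex exponential and its Taylor polynomials *)

Section ComplexBasics.
Context {R : realType}.
Local Notation C := (complex R).

Lemma complex_ext (z w : C) : Re z = Re w -> Im z = Im w -> z = w.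
Proof. by case: z w => [a b] [c d] /= -> ->. Qed.

Lemma Re_add (z w : C) : Re (z + w) = Re z + Re w.
Proof. by case: z w => [a b] [c d]. Qed.
Lemma Im_add (z w : C) : Im (z + w) = Im z + Im w.
Proof. by case: z w => [a b] [c d]. Qed.
Lemma Re_opp (z : C) : Re (- z) = - Re z.
Proof. by case: z. Qed.
Lemma Im_opp (z : C) : Im (- z) = - Im z.
Proof. by case: z. Qed.
Lemma Re_mul (z w : C) : Re (z * w) = Re z * Re w - Im z * Im w.
Proof. by case: z w => [a b] [c d]. Qed.
Lemma Im_mul (z w : C) : Im (z * w) = Re z * Im w + Im z * Re w.
Proof. by case: z w => [a b] [c d]. Qed.
Lemma Re_natr n : Re (n%:R : C) = n%:R.
Proof. by rewrite -(rmorph_nat (real_complex R)). Qed.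
Lemma Im_natr n : Im (n%:R : C) = 0.
Proof. by rewrite -(rmorph_nat (real_complex R)). Qed.
Lemma Re_mulr_real (z : C) (r : R) : Re (z * r%:C) = Re z * r.
Proof. by rewrite Re_mul /= mulr0 subr0. Qed.
Lemma Im_mulr_real (z : C) (r : R) : Im (z * r%:C) = Im z * r.
Proof. by rewrite Im_mul /= mulr0 add0r. Qed.
Lemma Re_mull_real (z : C) (r : R) : Re (r%:C * z) = r * Re z.
Proof. by rewrite mulrC Re_mulr_real mulrC. Qed.
Lemma Im_mull_real (z : C) (r : R) : Im (r%:C * z) = r * Im z.
Proof. by rewrite mulrC Im_mulr_real mulrC. Qed.

Lemma normcE (z : C) : normc z = Num.sqrt (abs2 z).
Proof. by case: z. Qed.

Lemma normc_ge0 (z : C) : 0 <= normc z.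
Proof. by rewrite normcE sqrtr_ge0. Qed.

Lemma abs2_ge0 (z : C) : 0 <= abs2 z.
Proof. by rewrite addr_ge0 ?sqr_ge0. Qed.

Lemma normc_sqr (z : C) : normc z ^+ 2 = abs2 z.
Proof. by rewrite normcE sqr_sqrtr ?abs2_ge0. Qed.

Lemma abs2M (z w : C) : abs2 (z * w) = abs2 z * abs2 w.
Proof. by rewrite -!normc_sqr normcM exprMn. Qed.

Lemma abs2X (z : C) n : abs2 (z ^+ n) = abs2 z ^+ n.
Proof.
elim: n => [|n IH]; last by rewrite !exprS abs2M IH.
by rewrite /abs2 /= expr1n expr0n addr0.
Qed.

Lemma abs2_real (r : R) : abs2 r%:C = r ^+ 2.
Proof. by rewrite /abs2 /= expr0n addr0. Qed.

Lemma normc_real (r : R) : normc r%:C = `|r|.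
Proof. by rewrite normcE abs2_real sqrtr_sqr. Qed.

Lemma norm_Re_le (z : C) : `|Re z| <= normc z.
Proof. by rewrite normcE -sqrtr_sqr ler_sqrt ?abs2_ge0// lerDl sqr_ge0. Qed.

Lemma norm_Im_le (z : C) : `|Im z| <= normc z.
Proof. by rewrite normcE -sqrtr_sqr ler_sqrt ?abs2_ge0// lerDr sqr_ge0. Qed.

Lemma normc_le (z : C) : normc z <= `|Re z| + `|Im z|.
Proof.
rewrite -(ler_pXn2r (n := 2)) ?nnegrE ?normc_ge0 ?addr_ge0//.
rewrite normc_sqr sqrrD !real_normK ?num_real// /abs2.
by rewrite -addrA lerD2l lerDr mulrn_wge0 ?mulr_ge0.
Qed.

Lemma normcX (z : C) n : normc (z ^+ n) = normc z ^+ n.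
Proof.
elim: n => [|n IH]; first by rewrite !expr0 normc_real normr1.
by rewrite !exprS normcM IH.
Qed.

(** The taxicab norm: this is the form in which the sizes of the real and
    imaginary parts enter the remainder estimate for the exponential. *)
Definition norm1 (z : C) : R := `|Re z| + `|Im z|.

Lemma norm1_ge0 (z : C) : 0 <= norm1 z. Proof. exact: addr_ge0. Qed.

Lemma Re_cexp (z : C) : Re (cexp z) = expR (Re z) * cos (Im z).
Proof. by rewrite /cexp Re_mull_real. Qed.

Lemma Im_cexp (z : C) : Im (cexp z) = expR (Re z) * sin (Im z).
Proof. by rewrite /cexp Im_mull_real. Qed.

Lemma cexpD (z w : C) : cexp (z + w) = cexp z * cexp w.
Proof.
apply: complex_ext.
  by rewrite Re_cexp Re_mul !Re_cexp !Im_cexp Re_add Im_add expRD cosD; ring.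
by rewrite Im_cexp Im_mul !Re_cexp !Im_cexp Re_add Im_add expRD sinD; ring.
Qed.

Lemma cexp0 : cexp 0 = 1 :> C.
Proof.
by apply: complex_ext; rewrite ?Re_cexp ?Im_cexp /= expR0 ?cos0 ?sin0 ?mulr1 ?mulr0.
Qed.

Lemma cexp_real (r : R) : cexp r%:C = (expR r)%:C.
Proof.
by apply: complex_ext; rewrite ?Re_cexp ?Im_cexp /= ?cos0 ?sin0 ?mulr1 ?mulr0.
Qed.

Lemma normc_cexp (z : C) : normc (cexp z) = expR (Re z).
Proof.
rewrite normcE /abs2 Re_cexp Im_cexp !exprMn -mulrDr cos2Dsin2 mulr1.
by rewrite sqrtr_sqr ger0_norm ?expR_ge0.
Qed.

Lemma abs2_cexp (z : C) : abs2 (cexp z) = expR (Re z *+ 2).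
Proof. by rewrite -normc_sqr normc_cexp -expRM_natl mulr_natl. Qed.

Lemma pow_fact_le_exp (n : nat) (t : R) : 0 <= t -> t ^+ n / n`!%:R <= expR t.
Proof.
move=> t0; case: n => [|n].
  by rewrite expr0 fact0 divr1 (le_trans _ (expR_ge1Dx _))// lerDl.
by rewrite (le_trans _ (expR_ge1Dxn n t0))// lerDr.
Qed.

(** Bernoulli's inequality, including negative increments. *)
Lemma bernoulli (d : R) m : -1 <= d -> 1 + m%:R * d <= (1 + d) ^+ m.
Proof.
move=> d1; have d0 : 0 <= 1 + d by lra.
elim: m => [|m IH]; first by rewrite mul0r expr0 addr0.
rewrite exprSr (le_trans _ (ler_wpM2r d0 IH))// -natr1.
have := mulr_ge0 (ler0n R m) (sqr_ge0 d); rewrite expr2; lra.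
Qed.

Definition cexp_poly (N : nat) (z : C) : C :=
  \sum_(k < N) z ^+ k / (k`!%:R : R)%:C.

(** Integrating a bound of Taylor type once.  It is obtained from the mean value
    theorem by comparison with the antiderivative of the bound. *)
Lemma deriv_bound (f df : R -> R) (K : R) (N : nat) :
  (forall x : R, is_derive x (1:R) f (df x)) -> f 0 = 0 ->
  (forall x : R, 0 <= x <= 1 -> `|df x| <= K * x ^+ N / N`!%:R) ->
  forall x : R, 0 <= x <= 1 -> `|f x| <= K * x ^+ N.+1 / N.+1`!%:R.
Proof.
move=> fdf f0 dfK.
have main (g dg : R -> R) : (forall x : R, is_derive x (1:R) g (dg x)) -> g 0 = 0 ->
  (forall x : R, 0 <= x <= 1 -> dg x <= K * x ^+ N / N`!%:R) ->
  forall x : R, 0 <= x <= 1 -> g x <= K * x ^+ N.+1 / N.+1`!%:R.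
  move=> gdg g0 dgK x /andP[]; rewrite le_eqVlt => /predU1P[<-|x0 x1].
    by rewrite g0 exprS !(mul0r, mulr0).
  pose G y := g y - K * y ^+ N.+1 / N.+1`!%:R.
  have GdG (y : R) : is_derive y (1:R) G (dg y - K * y ^+ N / N`!%:R).
    have -> : G = g - (K / N.+1`!%:R) \*: (@id R ^+ N.+1).
      by apply/funext => u; rewrite /G !fctE; congr (_ - _); exact: mulrAC.
    have ? := gdg y; apply: is_derive_eq.
    rewrite /GRing.scale /= mulr1 factS natrM invfM.
    by field; rewrite addrC natr1 !pnatr_eq0 -lt0n fact_gt0.
  have [u /[!in_itv] /= /andP[u0 ux]] := MVT x0 (fun y _ => GdG y)
    (derivable_within_continuous (fun y _ => @ex_derive _ _ _ _ _ _ _ (GdG y))).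
  have -> : G 0 = 0 by rewrite /G g0 exprS !(mul0r, mulr0, subrr).
  rewrite !subr0 => GE; rewrite -subr_le0 -/(G x) GE.
  by rewrite pmulr_lle0// subr_le0 dgK// ltW//= (le_trans (ltW ux)).
move=> x x0; rewrite ler_norml; apply/andP; split; last first.
  by apply: (main f df) => // y y0; exact: le_trans (ler_norm _) (dfK _ y0).
rewrite lerNl; apply: (main (- f) (fun x => - df x)) => //.
- by change (- f 0 = 0); rewrite f0 oppr0.
- by move=> y y0; rewrite (le_trans _ (dfK _ y0))// -normrN ler_norm.
Qed.

Lemma is_derive_Re_cexp (z : C) (t : R) :
  is_derive t (1:R) (fun u : R => Re (cexp (u%:C * z))) (Re (z * cexp (t%:C * z))).
Proof.
have -> : (fun u : R => Re (cexp (u%:C * z))) =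
    (expR \o ( *%R^~ (Re z))) * (@cos R \o ( *%R^~ (Im z))).
  by apply/funext => u; rewrite Re_cexp Re_mull_real Im_mull_real !fctE.
apply: is_derive_eq.
rewrite Re_mul Re_cexp Im_cexp Re_mull_real Im_mull_real /= /GRing.scale /=; ring.
Qed.

Lemma is_derive_Im_cexp (z : C) (t : R) :
  is_derive t (1:R) (fun u : R => Im (cexp (u%:C * z))) (Im (z * cexp (t%:C * z))).
Proof.
have -> : (fun u : R => Im (cexp (u%:C * z))) =
    (expR \o ( *%R^~ (Re z))) * (@sin R \o ( *%R^~ (Im z))).
  by apply/funext => u; rewrite Im_cexp Re_mull_real Im_mull_real !fctE.
apply: is_derive_eq.
rewrite Im_mul Re_cexp Im_cexp Re_mull_real Im_mull_real /= /GRing.scale /=; ring.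
Qed.

Lemma is_derive_exp_coeff (n : nat) (t : R) :
  is_derive t (1:R) (fun u : R => u ^+ n.+1 / n.+1`!%:R) (t ^+ n / n`!%:R).
Proof.
have -> : (fun u : R => u ^+ n.+1 / n.+1`!%:R) =
    (n.+1`!%:R)^-1 \*: (@id R ^+ n.+1).
  by apply/funext => u; rewrite !fctE mulrC.
apply: is_derive_eq; rewrite /GRing.scale /= mulr1 factS natrM invfM.
by field; rewrite addrC natr1 !pnatr_eq0 -lt0n fact_gt0.
Qed.

Lemma cexp_poly_real (N : nat) (z : C) (t : R) :
  cexp_poly N (t%:C * z) = \sum_(k < N) z ^+ k * (t ^+ k / k`!%:R)%:C.
Proof.
apply: eq_bigr => k _; rewrite exprMn mulrAC -rmorphXn -rmorphV.
  by rewrite mulrC -rmorphM.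
by rewrite unitfE pnatr_eq0 -lt0n fact_gt0.
Qed.

Lemma cexp_polyS (N : nat) (z : C) (t : R) :
  cexp_poly N.+1 (t%:C * z) =
  cexp_poly N (t%:C * z) + z ^+ N * (t ^+ N / N`!%:R)%:C.
Proof. by rewrite !cexp_poly_real big_ord_recr. Qed.

(** Along the ray [u |-> u z] the Taylor polynomials of the exponential satisfy
    the same differential equation as the exponential, up to a drop of the
    degree; so does the remainder, which is what [cexp_taylor_real] integrates. *)
Lemma is_derive_Re_poly (N : nat) (z : C) (t : R) :
  is_derive t (1:R) (fun u : R => Re (cexp_poly N.+1 (u%:C * z)))
    (Re (z * cexp_poly N (t%:C * z))).
Proof.
elim: N => [|N IH].
  have -> : (fun u : R => Re (cexp_poly 1 (u%:C * z))) = cst 1.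
    by apply/funext => u; rewrite cexp_poly_real big_ord1 !expr0 Re_mulr_real fact0 divr1 mulr1.
  by rewrite {1}/cexp_poly big_ord0 mulr0; exact: is_derive_cst.
have -> : (fun u : R => Re (cexp_poly N.+2 (u%:C * z))) =
  (fun u : R => Re (cexp_poly N.+1 (u%:C * z))) +
  Re (z ^+ N.+1) \*: (fun u : R => u ^+ N.+1 / N.+1`!%:R).
  by apply/funext => u; rewrite cexp_polyS Re_add Re_mulr_real.
have ? := is_derive_exp_coeff N t; apply: is_derive_eq.
by rewrite cexp_polyS mulrDr mulrA -exprS Re_add Re_mulr_real.
Qed.

Lemma is_derive_Im_poly (N : nat) (z : C) (t : R) :
  is_derive t (1:R) (fun u : R => Im (cexp_poly N.+1 (u%:C * z)))
    (Im (z * cexp_poly N (t%:C * z))).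
Proof.
elim: N => [|N IH].
  have -> : (fun u : R => Im (cexp_poly 1 (u%:C * z))) = cst 0.
    by apply/funext => u; rewrite cexp_poly_real big_ord1 !expr0 Im_mulr_real mul0r.
  by rewrite {1}/cexp_poly big_ord0 mulr0; exact: is_derive_cst.
have -> : (fun u : R => Im (cexp_poly N.+2 (u%:C * z))) =
  (fun u : R => Im (cexp_poly N.+1 (u%:C * z))) +
  Im (z ^+ N.+1) \*: (fun u : R => u ^+ N.+1 / N.+1`!%:R).
  by apply/funext => u; rewrite cexp_polyS Im_add Im_mulr_real.
have ? := is_derive_exp_coeff N t; apply: is_derive_eq.
by rewrite cexp_polyS mulrDr mulrA -exprS Im_add Im_mulr_real.
Qed.

Lemma cexp_poly0 (N : nat) : cexp_poly N.+1 0 = 1 :> C.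
Proof.
rewrite /cexp_poly big_ord_recl expr0 fact0 divr1 big1 ?addr0// => k _.
by rewrite exprS !mul0r.
Qed.

(** Induction on [N]: the remainder of order [N + 1] vanishes at [0] and its
    derivative along the ray is [z] times the remainder of order [N].  Real and
    imaginary parts are bounded separately, since the mean value theorem is a
    statement about real functions. *)
Lemma cexp_taylor_real (N : nat) (z : C) (t : R) : 0 <= t <= 1 ->
  `|Re (cexp (t%:C * z) - cexp_poly N (t%:C * z))| <=
    expR `|Re z| * norm1 z ^+ N * t ^+ N / N`!%:R /\
  `|Im (cexp (t%:C * z) - cexp_poly N (t%:C * z))| <=
    expR `|Re z| * norm1 z ^+ N * t ^+ N / N`!%:R.
Proof.
elim: N t => [|N IH] t t01.
  rewrite /cexp_poly big_ord0 subr0 !expr0 !mulr1 fact0 divr1.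
  have tz : normc (cexp (t%:C * z)) <= expR `|Re z|.
    rewrite normc_cexp Re_mull_real ler_expR (le_trans (ler_norm _))//.
    by move: t01 => /andP[t0 t1]; rewrite normrM (ger0_norm t0) ler_piMl.
  by rewrite (le_trans (norm_Re_le _) tz) (le_trans (norm_Im_le _) tz).
pose D N (u : R) : C := cexp (u%:C * z) - cexp_poly N (u%:C * z).
have D0 : D N.+1 0 = 0 by rewrite /D mul0r cexp0 cexp_poly0 subrr.
split.
- apply: (@deriv_bound (fun u => Re (D N.+1 u)) (fun u => Re (z * D N u))) => //.
  + move=> x.
    have -> : (fun u => Re (D N.+1 u)) = (fun u : R => Re (cexp (u%:C * z))) -
      (fun u : R => Re (cexp_poly N.+1 (u%:C * z))).
      by apply/funext => u; rewrite Re_add Re_opp.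
    have ? := is_derive_Re_cexp z x; have ? := is_derive_Re_poly N z x.
    by apply: is_derive_eq; rewrite mulrBr Re_add Re_opp.
  + by rewrite D0.
  + move=> x x01; have [ReB ImB] := IH _ x01.
    rewrite Re_mul (le_trans (ler_normB _ _))// !normrM.
    rewrite (le_trans (lerD (ler_wpM2l (normr_ge0 _) ReB) (ler_wpM2l (normr_ge0 _) ImB)))//.
    by rewrite -mulrDl le_eqVlt; apply/orP; left; apply/eqP; rewrite exprS /norm1; ring.
- apply: (@deriv_bound (fun u => Im (D N.+1 u)) (fun u => Im (z * D N u))) => //.
  + move=> x.
    have -> : (fun u => Im (D N.+1 u)) = (fun u : R => Im (cexp (u%:C * z))) -
      (fun u : R => Im (cexp_poly N.+1 (u%:C * z))).
      by apply/funext => u; rewrite Im_add Im_opp.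
    have ? := is_derive_Im_cexp z x; have ? := is_derive_Im_poly N z x.
    by apply: is_derive_eq; rewrite mulrBr Im_add Im_opp.
  + by rewrite D0.
  + move=> x x01; have [ReB ImB] := IH _ x01.
    rewrite Im_mul (le_trans (ler_normD _ _))// !normrM.
    rewrite (le_trans (lerD (ler_wpM2l (normr_ge0 _) ImB) (ler_wpM2l (normr_ge0 _) ReB)))//.
    by rewrite -mulrDl le_eqVlt; apply/orP; left; apply/eqP; rewrite exprS /norm1; ring.
Qed.

Lemma cexp_taylor (N : nat) (z : C) :
  normc (cexp z - cexp_poly N z) <=
    2 * expR `|Re z| * norm1 z ^+ N / N`!%:R.
Proof.
have [] := @cexp_taylor_real N z 1; first by rewrite ler01 lexx.
rewrite expr1n mulr1 mul1r => ReB ImB.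
rewrite (le_trans (normc_le _))// (le_trans (lerD ReB ImB))//.
by rewrite le_eqVlt; apply/orP; left; apply/eqP; ring.
Qed.

(** A bound uniform in [N]: it dominates the partial sums when the exponential
    series is integrated term by term. *)
Lemma cexp_poly_le (N : nat) (z : C) :
  normc (cexp_poly N z) <= 3 * expR (2 * norm1 z).
Proof.
have -> : cexp_poly N z = cexp z - (cexp z - cexp_poly N z) by ring.
rewrite (le_trans (le_normcD _ _))//.
rewrite normcN normc_cexp.
have NB := cexp_taylor N z.
have e1 : expR (Re z) <= expR (2 * norm1 z).
  rewrite ler_expR (le_trans (ler_norm _))// mulr_natl mulr2n /norm1.
  by have := normr_ge0 (Re z); have := normr_ge0 (Im z); lra.
have e2 : norm1 z ^+ N / N`!%:R <= expR (norm1 z).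
  exact/pow_fact_le_exp/norm1_ge0.
have e3 : expR `|Re z| * (norm1 z ^+ N / N`!%:R) <= expR (2 * norm1 z).
  rewrite mulr_natl mulr2n expRD ler_pM ?expR_ge0 ?divr_ge0 ?exprn_ge0 ?norm1_ge0//.
  by rewrite ler_expR /norm1 lerDl.
by move: NB; rewrite -!mulrA => NB; lra.
Qed.

End ComplexBasics.

(** * Limits of complex sequences *)

Section ComplexLimits.
Context {R : realType}.
Local Notation C := (complex R).

(** Convergence in modulus, with the modulus taken in the real field: it combines
    directly with real estimates. *)
Definition ccvg (u : nat -> C) (l : C) : Prop :=
  (fun n => normc (u n - l)) @ \oo --> (0 : R).

Lemma ccvg_squeeze (u : nat -> C) (l : C) (e : nat -> R) :
  (forall n, normc (u n - l) <= e n) -> e @ \oo --> (0 : R) -> ccvg u l.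
Proof.
move=> ue e0; apply: (squeeze_cvgr _ (@cvg_cst _ _ _ _ _) e0).
by apply: nearW => n; rewrite normc_ge0 ue.
Qed.

Lemma ccvg_unique (u : nat -> C) (l l' : C) : ccvg u l -> ccvg u l' -> l = l'.
Proof.
move=> ul ul'; apply/eqP; rewrite -subr_eq0; apply/eqP.
apply: eq0_normc.
have s0 : (fun n => normc (u n - l) + normc (u n - l')) @ \oo --> (0 : R).
  by rewrite -[0]addr0; exact: cvgD.
apply/eqP; rewrite eq_le normc_ge0 andbT -(cvg_lim _ s0)//.
apply: limr_ge; first by apply/cvg_ex; exists 0.
apply: nearW => n; have -> : l - l' = - (u n - l) + (u n - l') by ring.
by rewrite (le_trans (le_normcD _ _))// normcN.
Qed.

Lemma ccvgD (u v : nat -> C) (l m : C) :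
  ccvg u l -> ccvg v m -> ccvg (fun n => u n + v n) (l + m).
Proof.
move=> ul vm; apply: (@ccvg_squeeze _ _ (fun n => normc (u n - l) + normc (v n - m))).
  by move=> n; rewrite opprD addrACA le_normcD.
by rewrite -[0]addr0; exact: cvgD.
Qed.

Lemma ccvgZ (c : C) (u : nat -> C) (l : C) :
  ccvg u l -> ccvg (fun n => c * u n) (c * l).
Proof.
move=> ul; apply: (@ccvg_squeeze _ _ (fun n => normc c * normc (u n - l))).
  by move=> n; rewrite -mulrBr normcM.
by rewrite -[0](mulr0 (normc c)); apply: cvgMr.
Qed.

Lemma ccvg_cst (c : C) : ccvg (fun=> c) c.
Proof.
apply: (@ccvg_squeeze _ _ (fun=> 0)); last exact: cvg_cst.
by move=> n; rewrite subrr normc_real normr0.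
Qed.

Lemma ccvgS (u : nat -> C) (l : C) : ccvg u l <-> ccvg (fun n => u n.+1) l.
Proof. by rewrite /ccvg -(cvg_shiftS (fun n => normc (u n - l))). Qed.

Lemma ccvg_ReIm (u : nat -> C) (l : C) :
  (fun n => Re (u n)) @ \oo --> Re l -> (fun n => Im (u n)) @ \oo --> Im l ->
  ccvg u l.
Proof.
move=> ur ui.
apply: (@ccvg_squeeze _ _ (fun n => `|Re (u n) - Re l| + `|Im (u n) - Im l|)).
  by move=> n; rewrite (le_trans (normc_le _))// Re_add Im_add Re_opp Im_opp.
by rewrite -[0]addr0; apply: cvgD; apply/norm_cvg0P/subr_cvg0.
Qed.

Lemma ccvg_Re (u : nat -> C) (l : C) :
  ccvg u l -> (fun n => Re (u n)) @ \oo --> Re l.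
Proof.
move=> ul; apply/subr_cvg0/norm_cvg0P.
apply: (squeeze_cvgr _ (@cvg_cst _ _ _ _ _) ul).
by apply: nearW => n /=; rewrite normr_ge0 -Re_opp -Re_add norm_Re_le.
Qed.

Lemma ccvg_Im (u : nat -> C) (l : C) :
  ccvg u l -> (fun n => Im (u n)) @ \oo --> Im l.
Proof.
move=> ul; apply/subr_cvg0/norm_cvg0P.
apply: (squeeze_cvgr _ (@cvg_cst _ _ _ _ _) ul).
by apply: nearW => n /=; rewrite normr_ge0 -Im_opp -Im_add norm_Im_le.
Qed.

Lemma ccvg_cexp (z : C) : ccvg (fun N => cexp_poly N z) (cexp z).
Proof.
pose m := `|Re z| + `|Im z|.
apply: (@ccvg_squeeze _ _ (fun N => 2 * expR `|Re z| * exp_coeff m N)).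
  move=> n; rewrite -opprB normcN (le_trans (cexp_taylor _ _))//.
  by rewrite /exp_coeff mulrA.
by rewrite -[0](mulr0 (2 * expR `|Re z|)); apply: cvgMr; exact: cvg_exp_coeff.
Qed.

End ComplexLimits.

(** * Integrals of complex functions *)

Section ComplexIntegral.
Context d (T : measurableType d) {R : realType} (mu : {measure set T -> \bar R}).
Local Notation C := (complex R).

Definition cmeas (F : T -> C) : Prop :=
  measurable_fun [set: T] (fun p => Re (F p)) /\
  measurable_fun [set: T] (fun p => Im (F p)).

Definition cintegrable (F : T -> C) : Prop :=
  mu.-integrable [set: T] (EFin \o (fun p => Re (F p))) /\
  mu.-integrable [set: T] (EFin \o (fun p => Im (F p))).

(** Meaningful on [cintegrable] functions. *)
Definition cint (F : T -> C) : C :=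
  Complex (\int[mu]_p Re (F p)) (\int[mu]_p Im (F p)).

Lemma cmeasM (F G : T -> C) : cmeas F -> cmeas G -> cmeas (fun p => F p * G p).
Proof.
move=> [Fr Fi] [Gr Gi]; split.
  under eq_fun do rewrite Re_mul.
  by apply: measurable_funB; exact: measurable_funM.
under eq_fun do rewrite Im_mul.
by apply: measurable_funD; exact: measurable_funM.
Qed.

Lemma cmeasD (F G : T -> C) : cmeas F -> cmeas G -> cmeas (fun p => F p + G p).
Proof.
move=> [Fr Fi] [Gr Gi]; split.
  by under eq_fun do rewrite Re_add; exact: measurable_funD.
by under eq_fun do rewrite Im_add; exact: measurable_funD.
Qed.

Lemma cmeas_cst (c : C) : cmeas (fun=> c).
Proof. by split; exact: measurable_cst. Qed.

Lemma cmeas_real (f : T -> R) : measurable_fun setT f -> cmeas (fun p => (f p)%:C).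
Proof. by move=> mf; split => //=; exact: measurable_cst. Qed.

Lemma cmeasX (F : T -> C) n : cmeas F -> cmeas (fun p => F p ^+ n).
Proof.
move=> mF; elim: n => [|n IH]; first exact: cmeas_cst.
by under eq_fun do rewrite exprS; exact: cmeasM.
Qed.

Lemma cmeas_sum (F : nat -> T -> C) n : (forall k, cmeas (F k)) ->
  cmeas (fun p => \sum_(k < n) F k p).
Proof.
move=> mF; elim: n => [|n IH].
  by under eq_fun do rewrite big_ord0; exact: cmeas_cst.
by under eq_fun do rewrite big_ord_recr; exact: cmeasD.
Qed.

Lemma measurable_cos (f : T -> R) : measurable_fun setT f ->
  measurable_fun setT (fun p => cos (f p)).
Proof.
move=> mf; apply: (@measurableT_comp _ _ _ _ _ _ (@cos R)) => //.
by apply: continuous_measurable_fun; exact: continuous_cos.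
Qed.

Lemma measurable_sin (f : T -> R) : measurable_fun setT f ->
  measurable_fun setT (fun p => sin (f p)).
Proof.
move=> mf; apply: (@measurableT_comp _ _ _ _ _ _ (@sin R)) => //.
by apply: continuous_measurable_fun; exact: continuous_sin.
Qed.

Lemma measurable_fun_expR (f : T -> R) : measurable_fun setT f ->
  measurable_fun setT (fun p => expR (f p)).
Proof. by move=> mf; exact: measurableT_comp. Qed.

Lemma cmeas_cexp (F : T -> C) : cmeas F -> cmeas (fun p => cexp (F p)).
Proof.
move=> [Fr Fi]; split.
  under eq_fun do rewrite Re_cexp.
  by apply: measurable_funM; [exact: measurable_fun_expR|exact: measurable_cos].
under eq_fun do rewrite Im_cexp.
by apply: measurable_funM; [exact: measurable_fun_expR|exact: measurable_sin].
Qed.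

Lemma cmeas_conj (F : T -> C) : cmeas F -> cmeas (fun p => conjc (F p)).
Proof.
move=> [Fr Fi]; split.
  by apply: eq_measurable_fun Fr => p _ /=; case: (F p).
by apply: eq_measurable_fun (measurable_funN Fi) => p _ /=; case: (F p).
Qed.

Lemma measurable_abs2 (F : T -> C) : cmeas F ->
  measurable_fun setT (fun p => abs2 (F p)).
Proof. by move=> [Fr Fi]; apply: measurable_funD; exact: measurable_funX. Qed.

Lemma measurable_normc (F : T -> C) : cmeas F ->
  measurable_fun setT (fun p => normc (F p)).
Proof.
move=> mF; under eq_fun do rewrite normcE.
apply: (@measurableT_comp _ _ _ _ _ _ (@Num.sqrt R)); last exact: measurable_abs2.
by apply: continuous_measurable_fun; exact: sqrt_continuous.
Qed.

Lemma cintegrable_cmeas (F : T -> C) : cintegrable F -> cmeas F.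
Proof.
by move=> [/measurable_int Fr /measurable_int Fi]; split; exact/measurable_EFinP.
Qed.

Lemma integrable_dom (f g : T -> R) : measurable_fun setT f ->
  mu.-integrable setT (EFin \o g) -> (forall p, `|f p| <= g p) ->
  mu.-integrable setT (EFin \o f).
Proof.
move=> mf ig fg; apply: le_integrable ig => //; first exact/measurable_EFinP.
by move=> p _; rewrite !abse_EFin lee_fin (le_trans (fg p))// ler_norm.
Qed.

Lemma cintegrable_dom (F : T -> C) (g : T -> R) : cmeas F ->
  mu.-integrable setT (EFin \o g) -> (forall p, normc (F p) <= g p) ->
  cintegrable F.
Proof.
move=> [Fr Fi] ig Fg; split; apply: (integrable_dom _ ig) => // p.
  by rewrite (le_trans (norm_Re_le _)).
by rewrite (le_trans (norm_Im_le _)).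
Qed.

Lemma cintegrable_normc (F : T -> C) : cintegrable F ->
  mu.-integrable setT (EFin \o (fun p => normc (F p))).
Proof.
move=> iF; have [Fr Fi] := iF.
have iD := integrableD measurableT (integrable_norm Fr) (integrable_norm Fi).
apply: (@integrable_dom _ (fun p => `|Re (F p)| + `|Im (F p)|)) => //.
  exact/measurable_normc/cintegrable_cmeas.
by move=> p; rewrite ger0_norm ?normc_ge0// normc_le.
Qed.

Lemma cintegrableZ (c : C) (F : T -> C) : cintegrable F ->
  cintegrable (fun p => c * F p).
Proof.
move=> iF; apply: (@cintegrable_dom _ (fun p => normc c * normc (F p))).
- by apply: cmeasM; [exact: cmeas_cst|exact: cintegrable_cmeas].
- by have := integrableZl measurableT (normc c) (cintegrable_normc iF).
- by move=> p; rewrite normcM.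
Qed.

Lemma cintZ (c : C) (F : T -> C) : cintegrable F ->
  cint (fun p => c * F p) = c * cint F.
Proof.
move=> [Fr Fi].
have iZ (r : R) (f : T -> R) : mu.-integrable setT (EFin \o f) ->
  mu.-integrable setT (EFin \o (fun p => r * f p)).
  by move=> fi; have := integrableZl measurableT r fi.
apply: complex_ext; rewrite ?Re_mul ?Im_mul /=.
  under eq_Rintegral do rewrite Re_mul.
  by rewrite RintegralB ?RintegralZl//; exact: iZ.
under eq_Rintegral do rewrite Im_mul.
by rewrite RintegralD ?RintegralZl//; exact: iZ.
Qed.

Lemma cintegrableD (F G : T -> C) : cintegrable F -> cintegrable G ->
  cintegrable (fun p => F p + G p).
Proof.
move=> [Fr Fi] [Gr Gi]; split.
  under eq_fun do rewrite Re_add.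
  by have := integrableD measurableT Fr Gr.
under eq_fun do rewrite Im_add.
by have := integrableD measurableT Fi Gi.
Qed.

Lemma cintD (F G : T -> C) : cintegrable F -> cintegrable G ->
  cint (fun p => F p + G p) = cint F + cint G.
Proof.
move=> [Fr Fi] [Gr Gi]; apply: complex_ext; rewrite ?Re_add ?Im_add /=.
  by under eq_Rintegral do rewrite Re_add; rewrite RintegralD.
by under eq_Rintegral do rewrite Im_add; rewrite RintegralD.
Qed.

Lemma cintegrable0 : cintegrable (fun=> 0).
Proof. by split; exact: integrable0. Qed.

Lemma cintegrable_sum (F : nat -> T -> C) n : (forall k, cintegrable (F k)) ->
  cintegrable (fun p => \sum_(k < n) F k p).
Proof.
move=> mF; elim: n => [|n IH].
  by under eq_fun do rewrite big_ord0; exact: cintegrable0.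
by under eq_fun do rewrite big_ord_recr; exact: cintegrableD.
Qed.

Lemma cint_sum (F : nat -> T -> C) n : (forall k, cintegrable (F k)) ->
  cint (fun p => \sum_(k < n) F k p) = \sum_(k < n) cint (F k).
Proof.
move=> mF; elim: n => [|n IH].
  rewrite big_ord0; under [X in cint X]eq_fun do rewrite big_ord0.
  by apply: complex_ext; rewrite /= Rintegral_cst// mul0r.
rewrite big_ord_recr /= -IH -cintD//; last exact: cintegrable_sum.
by congr cint; apply/funext => p; rewrite big_ord_recr.
Qed.

(** The factor 2 is the price of bounding the real and the imaginary part
    separately. *)
Lemma normc_cint (F : T -> C) (g : T -> R) : cintegrable F ->
  mu.-integrable setT (EFin \o g) -> (forall p, normc (F p) <= g p) ->
  normc (cint F) <= 2 * \int[mu]_p g p.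
Proof.
move=> [Fr Fi] ig Fg; rewrite (le_trans (normc_le _))//= mulr_natl mulr2n.
apply: lerD; apply: (le_trans (le_normr_Rintegral _ _)) => //.
  apply: le_Rintegral => // [|p _]; first exact: integrable_norm.
  by rewrite (le_trans (norm_Re_le _)).
apply: le_Rintegral => // [|p _]; first exact: integrable_norm.
by rewrite (le_trans (norm_Im_le _)).
Qed.

Lemma Rintegral_dct (f : nat -> T -> R) (l g : T -> R) :
  (forall n, measurable_fun setT (f n)) ->
  (forall p, f ^~ p @ \oo --> l p) ->
  mu.-integrable setT (EFin \o g) ->
  (forall n p, `|f n p| <= g p) ->
  mu.-integrable setT (EFin \o l) /\
  (fun n => \int[mu]_p f n p) @ \oo --> \int[mu]_p l p.
Proof.
move=> mf fl ig fg.
have ml : measurable_fun setT l.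
  by apply: (measurable_fun_cvg mf) => p _; exact: fl.
have [il _ cl] : [/\ mu.-integrable setT (EFin \o l),
    (fun n => \int[mu]_p `|(f n p)%:E - (l p)%:E|)%E @ \oo --> 0%E &
    (fun n => \int[mu]_p (f n p)%:E)%E @ \oo --> (\int[mu]_p (l p)%:E)%E].
  apply: (@dominated_convergence _ _ _ mu setT measurableT
    (fun n => EFin \o f n) (EFin \o l) (EFin \o g)) => //.
  - by move=> n; exact/measurable_EFinP.
  - exact/measurable_EFinP.
  - by apply: aeW => p _ /=; apply: cvg_EFin; [exact: nearW|exact: fl].
  - by apply: aeW => p n _ /=; rewrite lee_fin.
split => //; rewrite /Rintegral; apply: fine_cvg.
by rewrite fineK// integrable_fin_num.
Qed.

Lemma cint_dct (F : nat -> T -> C) (L : T -> C) (g : T -> R) :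
  (forall n, cmeas (F n)) ->
  (forall p, ccvg (F ^~ p) (L p)) ->
  mu.-integrable setT (EFin \o g) ->
  (forall n p, normc (F n p) <= g p) ->
  cintegrable L /\ ccvg (fun n => cint (F n)) (cint L).
Proof.
move=> mF FL ig Fg.
have [|||iLr cr] := @Rintegral_dct (fun n p => Re (F n p)) (fun p => Re (L p)) g _ _ ig.
- by move=> n; have [] := mF n.
- by move=> p; apply: (@ccvg_Re _ (F ^~ p)); exact: FL.
- by move=> n p; rewrite (le_trans (norm_Re_le _)).
have [|||iLi ci] := @Rintegral_dct (fun n p => Im (F n p)) (fun p => Im (L p)) g _ _ ig.
- by move=> n; have [] := mF n.
- by move=> p; apply: (@ccvg_Im _ (F ^~ p)); exact: FL.
- by move=> n p; rewrite (le_trans (norm_Im_le _)).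
by split=> //; exact: ccvg_ReIm.
Qed.

End ComplexIntegral.

(** * Gaussian moments of the squared modulus *)

Section Gaussian.
Context {R : realType}.
Local Notation mu2 := (@lebesgue_measure R \x @lebesgue_measure R)%E.

Definition sqn (p : R * R) : R := abs2 (toC p).

Lemma sqn_ge0 p : 0 <= sqn p. Proof. exact: abs2_ge0. Qed.

Lemma measurable_sqn : measurable_fun [set: R * R] sqn.
Proof.
apply: measurable_funD; apply: measurable_funX => /=.
  exact: measurable_fst.
exact: measurable_snd.
Qed.

Lemma measurable_sqnX n : measurable_fun [set: R * R] (fun p => sqn p ^+ n).
Proof. by apply: measurable_funX; exact: measurable_sqn. Qed.

Lemma measurable_exp_sqn s : measurable_fun [set: R * R] (fun p => expR (- (s * sqn p))).
Proof.
apply: measurable_fun_expR; apply: measurable_funN; apply: measurable_funM => //.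
exact: measurable_sqn.
Qed.

(** The density of the normal law of variance [1 / (2 s)] has integral 1. *)
Lemma integral_gauss1 (s : R) : 0 < s ->
  (\int[@lebesgue_measure R]_x (expR (- (s * x ^+ 2)))%:E = (Num.sqrt (pi / s))%:E)%E.
Proof.
move=> s0; pose sigma := Num.sqrt (s^-1 / 2).
have sg2 : sigma ^+ 2 = s^-1 / 2 by rewrite sqr_sqrtr// divr_ge0// invr_ge0 ltW.
have sg0 : sigma != 0 by rewrite gt_eqF// sqrtr_gt0 divr_gt0// invr_gt0.
have pk0 := normal_peak_gt0 sg0.
have := integral_normal_pdf 0 sigma.
rewrite normal_pdfE//.
under eq_integral do rewrite EFinM.
rewrite ge0_integralZl//; last 3 first.
- by apply/measurable_EFinP; exact: measurable_normal_fun.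
- by move=> x _; rewrite lee_fin normal_fun_ge0.
- by rewrite lee_fin ltW.
have -> : (fun x : R => (normal_fun 0 sigma x)%:E) = (fun x => (expR (- (s * x ^+ 2)))%:E).
  apply/funext => x; rewrite /normal_fun subr0 sg2 -mulr_natr; congr (expR _)%:E.
  by field; rewrite gt_eqF.
have -> : (Num.sqrt (pi / s))%:E = ((normal_peak sigma)^-1%:E)%E :> \bar R.
  by rewrite /normal_peak invrK sg2 -mulr_natr; congr (Num.sqrt _)%:E; field; rewrite gt_eqF.
move=> h; rewrite -[LHS]mul1e -(@mulVf _ (normal_peak sigma)) ?gt_eqF//.
by rewrite EFinM -muleA h mule1.
Qed.

Lemma integral_gauss2 (s : R) : 0 < s ->
  (\int[mu2]_p (expR (- (s * sqn p)))%:E = (pi / s)%:E)%E.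
Proof.
move=> s0; rewrite fubini_tonelli1 /fubini_F//=; last first.
  by apply/measurable_EFinP; exact: measurable_exp_sqn.
have me : measurable_fun [set: R] (fun x : R => (expR (- (s * x ^+ 2)))%:E).
  apply/measurable_EFinP; apply: measurable_fun_expR; apply: measurable_funN.
  by apply: measurable_funM => //; exact: measurable_funX.
under eq_integral => x _.
  under eq_integral do rewrite /sqn /abs2 /= mulrDr opprD expRD EFinM.
  rewrite ge0_integralZl//=.
  rewrite integral_gauss1// muleC; over.
rewrite ge0_integralZl//=.
rewrite integral_gauss1// -EFinM -expr2 sqr_sqrtr// divr_ge0 ?pi_ge0//.
exact: ltW.
Qed.

Lemma integrable_gauss (s : R) : 0 < s ->
  mu2.-integrable setT (EFin \o (fun p => expR (- (s * sqn p)))).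
Proof.
move=> s0; apply/integrableP; split.
  by apply/measurable_EFinP; exact: measurable_exp_sqn.
under eq_integral => p _ do rewrite /= ger0_norm ?expR_ge0//.
by rewrite integral_gauss2// ltry.
Qed.

(** Powers are absorbed by an arbitrarily small exponential: this is why
    integrability for all decay rates above a threshold is unaffected by
    polynomial factors. *)
Lemma pow_le_exp (n : nat) (e t : R) : 0 < e -> 0 <= t ->
  t ^+ n <= n`!%:R / e ^+ n * expR (e * t).
Proof.
move=> e0 t0; have et0 : 0 <= e * t by rewrite mulr_ge0// ltW.
have := pow_fact_le_exp n et0; rewrite ler_pdivrMr ?ltr0n ?fact_gt0// exprMn => h.
by rewrite mulrAC ler_pdivlMr ?exprn_gt0// mulrC [leRHS]mulrC.
Qed.

Lemma integrable_sqn_gauss (n : nat) (s : R) : 0 < s ->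
  mu2.-integrable setT (EFin \o (fun p => sqn p ^+ n * expR (- (s * sqn p)))).
Proof.
move=> s0; have s20 : 0 < s / 2 by rewrite divr_gt0.
apply: (@integrable_dom _ _ _ mu2 (fun p => sqn p ^+ n * expR (- (s * sqn p)))
    (fun p => n`!%:R / (s / 2) ^+ n * expR (- (s / 2 * sqn p)))).
- by apply: measurable_funM; [exact: measurable_sqnX|exact: measurable_exp_sqn].
- by have := integrableZl measurableT (n`!%:R / (s / 2) ^+ n) (integrable_gauss s20).
- move=> p; rewrite ger0_norm ?mulr_ge0 ?expR_ge0 ?exprn_ge0 ?sqn_ge0//.
  rewrite (_ : - (s / 2 * sqn p) = s / 2 * sqn p + - (s * sqn p)); last by field.
  by rewrite expRD mulrA ler_wpM2r ?expR_ge0// pow_le_exp ?sqn_ge0.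
Qed.

(** A line through a point of the graph of a differentiable function that stays
    below the graph can only be the tangent.  Here the function is
    [(1 + d) ^- n.+1], and Bernoulli's inequality replaces differentiation. *)
Lemma tangent_slope (A : R) (n : nat) : 0 <= A ->
  (forall d : R, -1 < d -> 1 - d * A <= (1 + d) ^- n.+1) -> A = n.+1%:R.
Proof.
move=> A0 H.
have key d : -1 < d -> d * A <= 1 -> d * (n.+1%:R - A) <= d ^+ 2 * (A * n.+1%:R).
  move=> d1 dA; have d10 : 0 < 1 + d by lra.
  have := H _ d1; rewrite -[_ ^- _]mul1r ler_pdivlMr ?exprn_gt0// => h.
  have bern := bernoulli n.+1 (ltW d1).
  (* The hypothesis multiplied by [(1 + d) ^+ n.+1], after Bernoulli. *)
  have h1 : (1 - d * A) * (1 + n.+1%:R * d) <= 1.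
    by rewrite (le_trans _ h)// ler_wpM2l// subr_ge0.
  by rewrite expr2; lra.
have B0 : 0 <= A * n.+1%:R by rewrite mulr_ge0.
suff main : forall e, 0 < e -> A <= n.+1%:R + e /\ n.+1%:R <= A + e.
  apply/eqP; rewrite eq_le; apply/andP.
  by split; apply/ler_addgt0Pr => e /main[].
move=> e e0.
(* Small enough for [key] to apply at [d] and at [- d], and for its error term
   to be below [e]. *)
pose d := Num.min (1 / 2) (Num.min (1 + A)^-1 (e / (1 + A * n.+1%:R))).
have A10 : 0 < 1 + A by lra.
have B10 : 0 < 1 + A * n.+1%:R by lra.
have d0 : 0 < d by rewrite !lt_min divr_gt0// invr_gt0 A10 divr_gt0.
have d12 : d <= 1 / 2 by rewrite ge_min lexx.
have dA : d * (1 + A) <= 1.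
  by rewrite -ler_pdivlMr// div1r !ge_min lexx !orbT.
have dB : d * (1 + A * n.+1%:R) <= e.
  by rewrite -ler_pdivlMr// !ge_min lexx !orbT.
have dA1 : d * A <= 1 by lra.
have dA0 : 0 <= d * A by rewrite mulr_ge0// ltW.
have NdA : - d * A <= 1 by lra.
have k1 := key d ltac:(lra) dA1; have k2 := key (- d) ltac:(lra) NdA.
rewrite expr2 -mulrA ler_pM2l// in k1.
rewrite sqrrN expr2 -mulrA mulNr -mulrN ler_pM2l// in k2.
by split; lra.
Qed.

Definition gauss_moment (n : nat) (s : R) : R :=
  \int[mu2]_p (sqn p ^+ n * expR (- (s * sqn p))).

(** The tangent inequality for the convex function [s |-> gauss_moment n s], whose
    derivative is [- gauss_moment n.+1 s]; it comes from [1 + x <= expR x] under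
    the integral. *)
Lemma gauss_moment_tangent n s r : 0 < s -> 0 < r ->
  gauss_moment n s - (r - s) * gauss_moment n.+1 s <= gauss_moment n r.
Proof.
move=> s0 r0.
have i1 := integrableZl measurableT (r - s) (integrable_sqn_gauss n.+1 s0).
rewrite /gauss_moment -RintegralZl//; last exact: integrable_sqn_gauss.
rewrite -RintegralB//; last exact: integrable_sqn_gauss.
apply: le_Rintegral => //.
- by have := integrableB measurableT (integrable_sqn_gauss n s0) i1.
- exact: integrable_sqn_gauss.
move=> p _.
have -> : expR (- (r * sqn p)) = expR (- (s * sqn p)) * expR (- ((r - s) * sqn p)).
  by rewrite -expRD; congr expR; ring.
rewrite (_ : _ - _ = sqn p ^+ n * (expR (- (s * sqn p)) * (1 + - ((r - s) * sqn p)))).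
  apply: ler_wpM2l; first by rewrite exprn_ge0// sqn_ge0.
  by apply: ler_wpM2l; [exact: expR_ge0|exact: expR_ge1Dx].
by rewrite exprS; ring.
Qed.

(** Induction on [n].  If the [n]-th moment is known for every [s], then
    [gauss_moment_tangent] gives lines below its graph through each of its
    points, so [tangent_slope] yields the next moment. *)
Lemma gauss_momentE n (s : R) : 0 < s -> gauss_moment n s = pi * n`!%:R / s ^+ n.+1.
Proof.
elim: n s => [|n IH] s s0.
  rewrite /gauss_moment; under eq_Rintegral do rewrite expr0 mul1r.
  by rewrite /Rintegral integral_gauss2//= fact0 mulr1.
have n0 : 0 < n`!%:R :> R by rewrite ltr0n fact_gt0.
have K0 : 0 < pi * n`!%:R / s ^+ n.+1 :> R.
  by rewrite divr_gt0 ?exprn_gt0// mulr_gt0 ?pi_gt0.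
have s0' : s != 0 by rewrite gt_eqF.
have n0' : n`!%:R != 0 :> R by rewrite gt_eqF.
have pi0 : pi != 0 :> R by rewrite gt_eqF ?pi_gt0.
have sn0 : s ^+ n.+1 != 0 by rewrite gt_eqF ?exprn_gt0.
(* The slope of the tangent in the normalized variable [d], where the point is
   [s * (1 + d)]. *)
pose A := s * gauss_moment n.+1 s / (pi * n`!%:R / s ^+ n.+1).
have AE : A = n.+1%:R.
  apply: tangent_slope.
    rewrite divr_ge0 ?(ltW K0)// mulr_ge0 ?(ltW s0)//.
    by apply: Rintegral_ge0 => p _; rewrite mulr_ge0 ?expR_ge0// exprn_ge0 ?sqn_ge0.
  move=> d d1; have d10 : 0 < 1 + d by lra.
  have r0 : 0 < s * (1 + d) by rewrite mulr_gt0.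
  have := gauss_moment_tangent n s0 r0; rewrite !IH// => h.
  have dn0 : (1 + d) ^+ n.+1 != 0 by rewrite gt_eqF ?exprn_gt0.
  rewrite -(ler_pM2l K0); congr (_ <= _): h.
    by rewrite /A; move: (pi) pi0 => P P0; field; rewrite ?sn0 ?P0 ?n0' ?s0'.
  by rewrite exprMn; field; rewrite sn0 dn0.
have -> : gauss_moment n.+1 s = A * (pi * n`!%:R / s ^+ n.+1) / s.
  by rewrite /A; move: (pi) pi0 => P P0; field; rewrite ?sn0 ?P0 ?n0' ?s0'.
by rewrite AE factS natrM [in RHS]exprS; move: (pi) pi0 => P P0; field; rewrite ?sn0 ?s0'.
Qed.

End Gaussian.

(** * Rotation invariance of Lebesgue measure on the plane *)

Section Rotation.
Context {R : realType}.
Local Notation mu2 := (@lebesgue_measure R \x @lebesgue_measure R)%E.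
Local Notation plane := (measurableTypeR R * measurableTypeR R)%type.

(** Lebesgue measure is characterized by its values on half-open intervals. *)
Lemma lebesgue_shift (t : R) (A : set R) : measurable A ->
  lebesgue_measure ((fun x => x + t) @^-1` A) = lebesgue_measure A.
Proof.
pose f : measurableTypeR R -> measurableTypeR R := fun x => x + t.
have mf : measurable_fun [set: measurableTypeR R] f by exact: measurable_funD.
pose m := (pushforward (@lebesgue_measure R) f : {measure set _ -> \bar R}).
move=> mA; apply: esym; apply: (@lebesgue_measure_unique R (m mf)) => //.
move=> X [[a b] _ <-] /=; rewrite /pushforward.
have -> : f @^-1` `]a, b]%classic = `]a - t, b - t]%classic.
  by apply/seteqP; split => x; rewrite /f /= !in_itv /= ltrBlDr lerBrDr.
rewrite !lebesgue_measure_itv/= !lte_fin ltrD2r.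
by case: ifP => // _; rewrite -!EFinB; congr _%:E; ring.
Qed.

Definition preserves_area (f : plane -> plane) : Prop :=
  measurable_fun setT f /\ forall A, measurable A -> mu2 (f @^-1` A) = mu2 A.

Lemma preserves_area_comp (f g : plane -> plane) :
  preserves_area f -> preserves_area g -> preserves_area (f \o g).
Proof.
move=> [mf fA] [mg gA]; split; first exact: measurableT_comp.
move=> A mA; rewrite comp_preimage gA ?fA//.
by rewrite -[X in measurable X]setTI; exact: mf.
Qed.

(** A vertical shear translates each vertical section. *)
Lemma preserves_area_shear (t : R) :
  preserves_area (fun p => (p.1, p.2 + t * p.1)).
Proof.
split.
  apply/measurable_fun_pairP; split => /=; first exact: measurable_fst.
  apply: measurable_funD; first exact: measurable_snd.
  by apply: measurable_funM => //; exact: measurable_fst.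
move=> A mA; rewrite /product_measure1; apply: eq_integral => x _ /=.
rewrite -(@lebesgue_shift (t * x) (xsection A x)); last exact: measurable_xsection.
congr (lebesgue_measure _); apply/seteqP; split => y /=; rewrite /xsection /= ?inE //.
Qed.

Lemma preserves_area_swap : preserves_area (fun p => (p.2, p.1)).
Proof.
have ms : measurable_fun setT ((fun p => (p.2, p.1)) : plane -> plane).
  apply/measurable_fun_pairP; split => /=; first exact: measurable_snd.
  exact: measurable_fst.
split => // A mA; apply: esym.
pose m := (pushforward mu2 ((fun p => (p.2, p.1)) : plane -> plane) : {measure set _ -> \bar R}).
apply: (@product_measure_unique _ _ _ _ _ (@lebesgue_measure R)
  (@lebesgue_measure R) (m ms)) => // B D mB mD.
rewrite /= /pushforward.
have -> : (fun p : plane => (p.2, p.1)) @^-1` (B `*` D) = D `*` B.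
  by apply/seteqP; split => -[x y] /= [].
by rewrite product_measure1E// muleC.
Qed.

(** A rotation other than the half-turn is a product of three shears. *)
Lemma preserves_area_rot (al be : R) : al ^+ 2 + be ^+ 2 = 1 -> al != -1 ->
  preserves_area (fun p => (al * p.1 - be * p.2, be * p.1 + al * p.2)).
Proof.
move=> ab a1; have a10 : 1 + al != 0 by apply: contra a1 => /eqP h; apply/eqP; lra.
pose t := be / (1 + al).
(* A horizontal shear is a vertical one conjugated by the exchange of the
   coordinates. *)
have shx : preserves_area (fun p => (p.1 - t * p.2, p.2)).
  have := preserves_area_comp preserves_area_swap
   (preserves_area_comp (preserves_area_shear (- t)) preserves_area_swap).
  by congr preserves_area; apply/funext => -[x y] /=; rewrite mulNr.
have := preserves_area_comp shx (preserves_area_comp (preserves_area_shear be) shx).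
congr preserves_area; apply/funext => -[x y] /=.
have bb : be ^+ 2 = 1 - al ^+ 2 by rewrite -ab; ring.
by congr (_, _); rewrite /t; field: bb.
Qed.

Lemma integral_preserves (f : plane -> plane) (g : plane -> \bar R) :
  preserves_area f -> measurable_fun setT g ->
  (\int[mu2]_p g (f p) = \int[mu2]_p g p)%E.
Proof.
move=> [mf fA] mg.
have ge0 (h : plane -> \bar R) : measurable_fun setT h -> (forall p, 0 <= h p)%E ->
    (\int[mu2]_p h (f p) = \int[mu2]_p h p)%E.
  move=> mh h0.
  have h0' : {in [set: plane], forall y, (0 <= h y)%E} by move=> y _.
  have := ge0_integral_pushforward mf mu2 measurableT mh h0'.
  rewrite preimage_setT => E; apply: etrans (esym E) _.
  pose m := (pushforward mu2 f : {measure set _ -> \bar R}).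
  by apply: (@eq_measure_integral _ _ _ _ mu2 (m mf)) => A mA _; exact: fA.
rewrite [LHS]integralE [RHS]integralE; congr (_ - _)%E.
  rewrite -[RHS](ge0 _ (measurable_funepos mg) (funepos_ge0 g)).
  by apply: eq_integral => p _; rewrite !funeposE.
rewrite -[RHS](ge0 _ (measurable_funeneg mg) (funeneg_ge0 g)).
by apply: eq_integral => p _; rewrite !funenegE.
Qed.

Lemma cint_preserves (f : plane -> plane) (F : plane -> complex R) :
  preserves_area f -> cmeas F ->
  cint mu2 (fun p => F (f p)) = cint mu2 F.
Proof.
move=> pf [Fr Fi]; congr Complex; congr fine.
  by apply: (@integral_preserves f (EFin \o (fun p => Re (F p)))) => //;
    exact/measurable_EFinP.
by apply: (@integral_preserves f (EFin \o (fun p => Im (F p)))) => //;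
    exact/measurable_EFinP.
Qed.

End Rotation.

(** * Laplace moments and their recurrence *)

Section Moments.
Context {R : realType}.
Local Notation C := (complex R).
Local Notation mu2 := (@lebesgue_measure R \x @lebesgue_measure R)%E.
Local Notation plane := (measurableTypeR R * measurableTypeR R)%type.

Lemma natr_fact_neq0 n : (n`!%:R : C) != 0.
Proof. by rewrite pnatr_eq0 -lt0n fact_gt0. Qed.

(** Term by term integration of the exponential series of [z] against [h]. *)
Lemma cint_exp_series d (T : measurableType d) (mu : {measure set T -> \bar R})
  (h z : T -> C) (g : T -> R) : cmeas h -> cmeas z ->
  mu.-integrable setT (EFin \o g) ->
  (forall p, normc (h p) * expR (2 * norm1 (z p)) <= g p) ->
  [/\ forall k, cintegrable mu (fun p => h p * z p ^+ k),
    cintegrable mu (fun p => h p * cexp (z p)) &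
    ccvg (fun N => \sum_(k < N) cint mu (fun p => h p * z p ^+ k) / k`!%:R)
    (cint mu (fun p => h p * cexp (z p)))].
Proof.
move=> mh mz ig hg.
have ik k : cintegrable mu (fun p => h p * z p ^+ k).
  apply: (@cintegrable_dom _ _ _ _ _ (fun p => k`!%:R * g p)).
  - by apply: cmeasM => //; exact: cmeasX.
  - by have := integrableZl measurableT k`!%:R ig.
  move=> p; have f0 : 0 < k`!%:R :> R by rewrite ltr0n fact_gt0.
  rewrite -ler_pdivrMl// (le_trans _ (hg p))//.
  rewrite normcM normcX mulrCA ler_wpM2l ?normc_ge0//.
  rewrite mulrC (le_trans (pow_fact_le_exp _ (normc_ge0 _)))// ler_expR.
  by have := normc_le (z p); have := norm1_ge0 (z p); rewrite /norm1; lra.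
have part N : (fun p => h p * cexp_poly N (z p)) =
    (fun p => \sum_(k < N) (k`!%:R)^-1 * (h p * z p ^+ k)).
  apply/funext => p; rewrite /cexp_poly mulr_sumr; apply: eq_bigr => k _.
  by rewrite rmorph_nat mulrA mulrC.
have [] := @cint_dct _ _ _ mu (fun N p => h p * cexp_poly N (z p))
  (fun p => h p * cexp (z p)) (fun p => 3 * g p).
- move=> N; apply: cmeasM => //.
  apply: (@cmeas_sum _ _ _ (fun k p => z p ^+ k / (k`!%:R)%:C)) => k.
  by apply: cmeasM; [exact: cmeasX|exact: cmeas_cst].
- by move=> p; apply: ccvgZ; exact: ccvg_cexp.
- by have := integrableZl measurableT 3 ig.
- move=> N p; rewrite normcM.
  have := ler_wpM2l (normc_ge0 (h p)) (cexp_poly_le N (z p)).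
  by have := hg p; rewrite -/(norm1 (z p)); lra.
move=> iL cL; split => //.
congr ccvg: cL; apply/funext => N.
rewrite part (@cint_sum _ _ _ mu (fun k p => (k`!%:R)^-1 * (h p * z p ^+ k))).
  by apply: eq_bigr => k _; rewrite cintZ// mulrC.
by move=> k; exact: cintegrableZ.
Qed.

(** Absolute convergence of the Laplace integral of [h] in the variable [sqn p] on
    the half-plane [s0 < Re s]. *)
Definition expdecay (s0 : R) (h : plane -> C) : Prop :=
  cmeas h /\ forall s, s0 < s ->
    mu2.-integrable setT (EFin \o (fun p => normc (h p) * expR (- (s * sqn p)))).

(** The integral [M_n(s)]: up to sign, the [n]-th derivative at [s] of the Laplace
    transform of [h] in the variable [sqn p]. *)
Definition moment (h : plane -> C) (n : nat) (s : C) : C :=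
  cint mu2 (fun p => h p * (sqn p ^+ n)%:C * cexp (- s * (sqn p)%:C)).

Lemma expdecay_sqn s0 h n s : expdecay s0 h -> s0 < s ->
  mu2.-integrable setT
    (EFin \o (fun p => normc (h p) * sqn p ^+ n * expR (- (s * sqn p)))).
Proof.
move=> [mh dh] s0s; pose e := (s - s0) / 2.
have e0 : 0 < e by rewrite divr_gt0// subr_gt0.
have ss : s0 < s - e by rewrite /e; lra.
pose K := n`!%:R / e ^+ n.
apply: (@integrable_dom _ _ _ mu2
    (fun p => normc (h p) * sqn p ^+ n * expR (- (s * sqn p)))
    (fun p => K * (normc (h p) * expR (- ((s - e) * sqn p))))).
- apply: measurable_funM; last exact: measurable_exp_sqn.
  by apply: measurable_funM; [exact: measurable_normc|exact: measurable_sqnX].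
- by have := integrableZl measurableT K (dh _ ss).
- move=> p; rewrite ger0_norm ?mulr_ge0 ?expR_ge0 ?exprn_ge0 ?sqn_ge0 ?normc_ge0//.
  have -> : - ((s - e) * sqn p) = e * sqn p - s * sqn p by ring.
  rewrite expRD -[leLHS]mulrA [leRHS]mulrCA ler_wpM2l ?normc_ge0//.
  by rewrite mulrA ler_wpM2r ?expR_ge0// pow_le_exp ?sqn_ge0.
Qed.

Lemma cmeas_moment h n s : cmeas h ->
  cmeas (fun p : plane => h p * (sqn p ^+ n)%:C * cexp (- s * (sqn p)%:C)).
Proof.
move=> mh; apply: cmeasM.
  by apply: cmeasM => //; apply: cmeas_real; exact: measurable_sqnX.
apply: cmeas_cexp; apply: cmeasM; first exact: cmeas_cst.
by apply: cmeas_real; exact: measurable_sqn.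
Qed.

Lemma normc_moment (h : plane -> C) n s p :
  normc (h p * (sqn p ^+ n)%:C * cexp (- s * (sqn p)%:C)) =
  normc (h p) * sqn p ^+ n * expR (- (Re s * sqn p)).
Proof.
rewrite normcM normc_cexp normcM normc_real Re_mulr_real Re_opp mulNr.
by rewrite ger0_norm// exprn_ge0 ?sqn_ge0.
Qed.

Lemma cintegrable_moment s0 h n s : expdecay s0 h -> s0 < Re s ->
  cintegrable mu2 (fun p => h p * (sqn p ^+ n)%:C * cexp (- s * (sqn p)%:C)).
Proof.
move=> dh s0s; apply: cintegrable_dom (expdecay_sqn n dh s0s) _.
  by apply: cmeas_moment; have [] := dh.
by move=> p; rewrite normc_moment.
Qed.

(** The Taylor expansion of [M_n] at [s].  The factor 2 in the condition on [de] is
    the one in [cexp_poly_le]. *)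
Lemma moment_series s0 h n s de : expdecay s0 h -> s0 + 2 * norm1 de < Re s ->
  ccvg (fun N => \sum_(k < N) ((- de) ^+ k / k`!%:R) * moment h (n + k) s)
       (moment h n (s + de)).
Proof.
move=> dh sde; have [mh _] := dh.
have de0 := norm1_ge0 de.
have s0s : s0 < Re s by lra.
have s0s' : s0 < Re s - 2 * norm1 de by lra.
have sz p : norm1 (- de * (sqn p)%:C) = norm1 de * sqn p.
  rewrite /norm1 Re_mulr_real Im_mulr_real Re_opp Im_opp !mulNr !normrN !normrM.
  by rewrite (ger0_norm (sqn_ge0 p)) mulrDl.
have [] := @cint_exp_series _ _ mu2
  (fun p => h p * (sqn p ^+ n)%:C * cexp (- s * (sqn p)%:C))
  (fun p => - de * (sqn p)%:C) _ (cmeas_moment n s mh) _ (expdecay_sqn n dh s0s').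
- apply: cmeasM; first exact: cmeas_cst.
  by apply: cmeas_real; exact: measurable_sqn.
- move=> p; rewrite normc_moment -mulrA -expRD sz.
  by rewrite le_eqVlt; apply/orP; left; apply/eqP; congr (_ * expR _); ring.
move=> ik iL; congr ccvg.
  apply/funext => N; apply: eq_bigr => k _; rewrite /moment -cintZ; last first.
    exact: cintegrable_moment dh s0s.
  rewrite mulrC -cintZ//; congr cint; apply/funext => p.
  by rewrite exprMn exprD !rmorphM !rmorphXn /=; ring.
congr cint; apply/funext => p; rewrite -mulrA -cexpD; congr (_ * cexp _); ring.
Qed.

(** For a function of [t] on the half-line, these are the equations satisfied by
    [c e^(-c t)], obtained from an integration by parts.  For [n = 0] the first
    term on the right vanishes, whatever [n.-1] denotes. *)
Definition moment_rec (c : C) (h : plane -> C) (s : C) : Prop :=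
  forall n, (c + s) * moment h n s = n%:R * moment h n.-1 s + (if n == 0%N then c else 0).

(** With [a k] the coefficients of the expansion in [moment_series], the relations
    at [s] give
      [(c + s) S_n = n S_(n-1) - de S_n + (c if n = 0)]
    for the partial sums, because [k a_k = - de a_(k-1)] absorbs the part of the
    factor [n + k] that comes from the expansion.  In the limit the term in [de]
    moves to the left-hand side and turns [c + s] into [c + s + de]. *)
Lemma moment_rec_step s0 h c s de : expdecay s0 h -> s0 + 2 * norm1 de < Re s ->
  moment_rec c h s -> moment_rec c h (s + de).
Proof.
move=> dh sde Hs n.
pose a k : C := (- de) ^+ k / k`!%:R.
pose S n N := \sum_(k < N) a k * moment h (n + k) s.
have SL m : ccvg (S m) (moment h m (s + de)) by exact: moment_series dh sde.
have aS k : a k.+1 * k.+1%:R = - de * a k.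
  rewrite /a exprS factS natrM; field.
  by rewrite natr_fact_neq0 addrC natr1 pnatr_eq0.
have key N : (c + s) * S n N.+1 =
   n%:R * S n.-1 N.+1 + (- de * S n N + (if n == 0%N then c else 0)).
  have -> : (c + s) * S n N.+1 = \sum_(k < N.+1)
     (n%:R * (a k * moment h (n.-1 + k) s) +
      (a k * k%:R * moment h (n + k.-1) s + (if (n + k == 0)%N then c else 0))).
    rewrite /S mulr_sumr; apply: eq_bigr => k _; rewrite mulrCA Hs.
    case: (nat_of_ord k) => [|j]; case: n => [|m].
    - by rewrite /a expr0 fact0 divr1 /=; ring.
    - by rewrite !addn0 /=; ring.
    - by rewrite !add0n /=; ring.
    - rewrite addnS addSn /= -addnS -addSnnS /=.
      have -> : (m.+1 + j).+1%:R = m.+1%:R + j.+1%:R :> C.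
        by rewrite -natrD addnS.
      by ring.
  rewrite !big_split /= -mulr_sumr; congr (_ + (_ + _)).
    rewrite big_ord_recl mulr0 mul0r add0r /S mulr_sumr.
    by apply: eq_bigr => k _; rewrite lift0 succnK aS -mulrA.
  rewrite big_ord_recl addn0 big1 ?addr0// => k _.
  by rewrite lift0 addnS.
have L1 : ccvg (fun N => (c + s) * S n N.+1) ((c + s) * moment h n (s + de)).
  by apply: ccvgZ; exact: (ccvgS _ _).1 (SL _).
have L2 : ccvg (fun N => (c + s) * S n N.+1) (n%:R * moment h n.-1 (s + de)
   + (- de * moment h n (s + de) + (if n == 0%N then c else 0))).
  under eq_fun do rewrite key.
  apply: ccvgD; first by apply: ccvgZ; exact: (ccvgS _ _).1 (SL _).
  by apply: ccvgD; [exact: ccvgZ|exact: ccvg_cst].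
have := ccvg_unique L1 L2 => E.
by rewrite addrA mulrDl E; ring.
Qed.

(** The segment from [0] to [s] stays at a positive distance from the line
    [Re = s0], so it can be covered by steps of a fixed small size. *)
Lemma moment_rec_propagate s0 h c s : s0 < 0 -> expdecay s0 h -> s0 < Re s ->
  moment_rec c h 0 -> moment_rec c h s.
Proof.
move=> s00 dh s0s H0.
(* The smallest real part on the segment from [0] to [s]. *)
pose rho := Num.min 0 (Re s).
have rho0 : 0 < rho - s0 by rewrite subr_gt0 /rho lt_min s00.
pose N := (Num.bound (2 * norm1 s / (rho - s0))).
have N0 : 0 < N.+1%:R :> R by [].
have HN : 2 * norm1 s / N.+1%:R < rho - s0.
  have b0 : 0 <= 2 * norm1 s / (rho - s0).
    by rewrite divr_ge0 ?(ltW rho0)// mulr_ge0 ?norm1_ge0.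
  have hb : 2 * norm1 s / (rho - s0) < N.+1%:R.
    by rewrite (lt_trans (archi_boundP b0))// ltr_nat.
  by move: hb; rewrite ltr_pdivrMr// => hb; rewrite ltr_pdivrMr// [ltRHS]mulrC.
pose de : C := s * (N.+1%:R^-1)%:C.
have sde : norm1 de = norm1 s / N.+1%:R.
  rewrite /norm1 /de Re_mulr_real Im_mulr_real !normrM (@ger0_norm _ N.+1%:R^-1) ?invr_ge0//.
  by rewrite mulrDl.
have step k : (k <= N.+1)%N -> moment_rec c h (k%:R * de).
  elim: k => [|k IH] kN; first by rewrite mul0r.
  have -> : k.+1%:R * de = k%:R * de + de by rewrite -natr1; ring.
  apply: (moment_rec_step dh); last by apply: IH; exact: ltnW.
  rewrite sde.
  have -> : k%:R * de = s * (k%:R / N.+1%:R)%:C.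
    by rewrite /de rmorphM rmorph_nat; ring.
  rewrite Re_mulr_real.
  move: HN; rewrite -mulrA => HN.
  suff hr : rho <= Re s * (k%:R / N.+1%:R).
    by rewrite addrC -ltrBrDr (lt_le_trans HN)// lerD2r.
  have t0 : 0 <= k%:R / N.+1%:R :> R by rewrite divr_ge0.
  have t1 : k%:R / N.+1%:R <= 1 :> R by rewrite ler_pdivrMr// mul1r ler_nat ltnW.
  rewrite /rho ge_min; have [Rs|Rs] := leP 0 (Re s).
    by rewrite mulr_ge0.
  apply/orP; right; rewrite -subr_ge0.
  have -> : Re s * (k%:R / N.+1%:R) - Re s = - Re s * (1 - k%:R / N.+1%:R) by ring.
  by rewrite mulr_ge0 ?subr_ge0 ?oppr_ge0// ltW.
have := step N.+1 (leqnn _); congr moment_rec.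
by rewrite /de fmorphV rmorph_nat mulrCA divff ?mulr1// pnatr_eq0.
Qed.

End Moments.

(** * Diagonal action of radial symbols *)

Section Eigen.
Context {R : realType}.
Local Notation C := (complex R).
Local Notation mu2 := (@lebesgue_measure R \x @lebesgue_measure R)%E.
Local Notation plane := (measurableTypeR R * measurableTypeR R)%type.

(** The function [phi] with the Gaussian weight, as a function on the plane. *)
Definition weighted (phi : C -> C) (p : plane) : C := phi (toC p) * (gauss p)%:C.

Lemma integral_muE f : integral_mu f = cint mu2 (weighted f).
Proof.
congr Complex; apply: eq_Rintegral => p _; first by rewrite Re_mulr_real.
by rewrite Im_mulr_real.
Qed.

Lemma cmeas_toC : cmeas (fun p : plane => toC p).
Proof. by split; [exact: measurable_fst|exact: measurable_snd]. Qed.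

Lemma gauss_ge0 (p : plane) : 0 <= gauss p.
Proof. by rewrite mulr_ge0 ?expR_ge0// invr_ge0 pi_ge0. Qed.

Lemma gauss_gt0 (p : plane) : 0 < gauss p.
Proof. by rewrite mulr_gt0 ?expR_gt0// invr_gt0 pi_gt0. Qed.

Lemma gaussE (p : plane) : gauss p = pi^-1 * expR (- (1 * sqn p)).
Proof. by rewrite mul1r. Qed.

Lemma measurable_gauss : measurable_fun [set: plane] (fun p => gauss p).
Proof.
under eq_fun do rewrite gaussE.
by apply: measurable_funM => //; exact: measurable_exp_sqn.
Qed.

Lemma cmeas_weighted phi : cmeasurable phi -> cmeas (weighted phi).
Proof.
move=> mphi; apply: cmeasM => //.
by apply: cmeas_real; exact: measurable_gauss.
Qed.

Lemma L2P phi : cmeasurable phi -> L2 phi <->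
  mu2.-integrable setT (EFin \o (fun p => abs2 (phi (toC p)) * gauss p)).
Proof.
move=> mphi.
have mf : measurable_fun [set: plane] (fun p => abs2 (phi (toC p)) * gauss p).
  apply: measurable_funM; last exact: measurable_gauss.
  exact: (@measurable_abs2 _ _ _ (fun p => phi (toC p))).
have E : (\int[mu2]_p `|(abs2 (phi (toC p)) * gauss p)%:E| =
    \int[mu2]_p (abs2 (phi (toC p)) * gauss p)%:E)%E.
  apply: eq_integral => p _; rewrite gee0_abs// lee_fin.
  by rewrite mulr_ge0 ?abs2_ge0 ?gauss_ge0.
split=> [[_ foo]|/integrableP[_ foo]].
  by apply/integrableP; split; [exact/measurable_EFinP|rewrite E].
by split => //; rewrite -E.
Qed.

(** The arithmetic-geometric inequality applied to the modulus of [phi] and to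
    [e^(-s t)]: the square of the latter is integrable against the Gaussian
    weight exactly when [1 + 2 s > 0]. *)
Lemma expdecay_weighted phi : L2 phi -> expdecay (- (1 / 2)) (weighted phi).
Proof.
move=> L2phi; have mphi := L2phi.1; split; first exact: cmeas_weighted.
move=> s s2; have i1 := (L2P mphi).1 L2phi.
have s0 : 0 < 1 + 2 * s by lra.
have i2 := integrableZl measurableT pi^-1 (integrable_gauss s0).
apply: (@integrable_dom _ _ _ mu2 _ (fun p => abs2 (phi (toC p)) * gauss p +
   pi^-1 * expR (- ((1 + 2 * s) * sqn p)))).
- apply: measurable_funM; last exact: measurable_exp_sqn.
  exact/measurable_normc/cmeas_weighted.
- by have := integrableD measurableT i1 i2.
move=> p; rewrite ger0_norm ?mulr_ge0 ?expR_ge0 ?normc_ge0//.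
rewrite /weighted normcM normc_real (ger0_norm (gauss_ge0 p)).
rewrite -normc_sqr gaussE.
have -> : expR (- ((1 + 2 * s) * sqn p)) =
   expR (- (1 * sqn p)) * expR (- (s * sqn p)) ^+ 2.
  by rewrite -expRM_natl -expRD; congr expR; ring.
have p0 : 0 <= pi^-1 :> R by rewrite invr_ge0 pi_ge0.
set N := normc _; set E := expR (- (s * _)); set G := expR _.
have G0 : 0 <= pi^-1 * G by rewrite mulr_ge0 ?expR_ge0.
rewrite [pi^-1 * (_ * _ ^+ 2)]mulrA -subr_ge0; move: G0; set M := pi^-1 * G => G0.
have -> : N ^+ 2 * M + M * E ^+ 2 - N * M * E =
  M * (((N - E) ^+ 2 + N ^+ 2 + E ^+ 2) / 2) by field.
by rewrite mulr_ge0// divr_ge0// !addr_ge0 ?sqr_ge0.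
Qed.

Lemma normc_toC (p : plane) : normc (toC p) ^+ 2 = sqn p.
Proof. exact: normc_sqr. Qed.

(** A linear exponent is dominated by a quadratic one, by completing the
    square. *)
Lemma growth_le (e r : R) (m : nat) : 0 < e -> 0 <= r ->
  exists2 K, 0 <= K & forall x : R, 0 <= x ->
    x ^+ m * expR (r * x) <= K * expR (e * x ^+ 2).
Proof.
move=> e0 r0; exists (m`!%:R * expR ((r + 1) ^+ 2 / (4 * e))).
  by rewrite mulr_ge0 ?expR_ge0.
move=> x x0.
have := pow_le_exp m ltr01 x0; rewrite expr1n divr1 mul1r => xm.
rewrite (le_trans (ler_wpM2r (expR_ge0 _) xm))//.
rewrite -mulrA -[leRHS]mulrA ler_wpM2l// -!expRD ler_expR -subr_ge0.
have -> : (r + 1) ^+ 2 / (4 * e) + e * x ^+ 2 - (x + r * x) =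
   e * (x - (r + 1) / (2 * e)) ^+ 2 by field; rewrite gt_eqF.
by rewrite mulr_ge0 ?sqr_ge0// ltW.
Qed.

Lemma dominated_growth s0 h r m : s0 < 0 -> expdecay s0 h -> 0 <= r ->
  exists2 g : plane -> R, mu2.-integrable setT (EFin \o g) &
    forall p, normc (h p) * normc (toC p) ^+ m * expR (r * normc (toC p)) <= g p.
Proof.
move=> s00 [mh dh] r0; have e0 : 0 < - (s0 / 2) by lra.
have [K K0 HK] := growth_le m e0 r0.
have s2 : s0 < s0 / 2 by lra.
exists (fun p => K * (normc (h p) * expR (- (s0 / 2 * sqn p)))).
  by have := integrableZl measurableT K (dh _ s2).
move=> p; rewrite -mulrA [leRHS]mulrCA ler_wpM2l ?normc_ge0// -mulNr -normc_toC.
exact/HK/normc_ge0.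
Qed.

Definition rot_invariant (h : plane -> C) : Prop :=
  forall p p', sqn p = sqn p' -> h p = h p'.

Lemma normc_conj (z : C) : normc (conjc z) = normc z.
Proof. by case: z => x y; rewrite !normcE /abs2 /= sqrrN. Qed.

Lemma rot_invariant_weighted (phi : C -> C) : radial phi ->
  rot_invariant (weighted phi).
Proof.
move=> rphi p p' pp'; rewrite /weighted !gaussE pp'; congr (_ * _).
by apply: rphi; rewrite !normc_def; congr (Num.sqrt _)%:C.
Qed.

Definition mixed_moment (h : plane -> C) (j k : nat) : C :=
  cint mu2 (fun p => h p * (toC p ^+ j * conjc (toC p) ^+ k)).

Lemma cintegrable_mixed s0 h j k : s0 < 0 -> expdecay s0 h ->
  cintegrable mu2 (fun p => h p * (toC p ^+ j * conjc (toC p) ^+ k)).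
Proof.
move=> s00 dh; have [g ig hg] := dominated_growth (j + k) s00 dh (lexx 0).
apply: (@cintegrable_dom _ _ _ _ _ g) => //.
  apply: cmeasM; first exact: dh.1.
  by apply: cmeasM; apply: cmeasX; [|apply: cmeas_conj]; exact: cmeas_toC.
move=> p; apply: le_trans (hg p); rewrite mul0r expR0 mulr1.
by rewrite !normcM !normcX normc_conj exprD.
Qed.

Lemma cexp_natl n (z : C) : cexp (n%:R * z) = cexp z ^+ n.
Proof.
elim: n => [|n IH]; first by rewrite mul0r cexp0.
by rewrite -natr1 mulrDl mul1r cexpD IH exprSr.
Qed.

Lemma Re_conj (z : C) : Re (conjc z) = Re z. Proof. by case: z. Qed.

Lemma Im_conj (z : C) : Im (conjc z) = - Im z. Proof. by case: z. Qed.

Lemma cexp_conj (z : C) : conjc (cexp z) = cexp (conjc z).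
Proof.
apply: complex_ext; first by rewrite Re_conj !Re_cexp Re_conj Im_conj cosN.
by rewrite Im_conj !Im_cexp Re_conj Im_conj sinN mulrN.
Qed.

(** The rotation by the angle [th] multiplies this moment by
    [e^(i (j - k) th)].  The angle [(pi / 2) / (j - k)] makes this factor equal to
    the imaginary unit, and it is never the half-turn excluded by
    [preserves_area_rot]. *)
Lemma mixed_moment_eq0 s0 h j k : s0 < 0 -> expdecay s0 h -> rot_invariant h ->
  j != k -> mixed_moment h j k = 0.
Proof.
move=> s00 dh rh jk.
pose th : R := pi / 2 / (j%:R - k%:R).
have jk0 : j%:R - k%:R != 0 :> R by rewrite subr_eq0 eqr_nat.
have jk1 : 1 <= `|j%:R - k%:R| :> R.
  move: jk; rewrite neq_ltn => /orP[jk|jk].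
    by rewrite distrC ger0_norm ?subr_ge0 ?ler_nat 1?ltnW// lerBrDl natr1 ler_nat.
  by rewrite ger0_norm ?subr_ge0 ?ler_nat 1?ltnW// lerBrDl natr1 ler_nat.
have thpi : `|th| <= pi / 2.
  rewrite /th normrM normfV ger0_norm ?divr_ge0 ?pi_ge0//.
  by rewrite ler_piMr ?divr_ge0 ?pi_ge0// invf_le1// (lt_le_trans ltr01).
have cth : cos th != -1.
  rewrite gt_eqF// (lt_le_trans (ltrN10 R))// cos_ge0_pihalf//.
  by rewrite -ler_norml.
have pr := preserves_area_rot (cos2Dsin2 th) cth.
set rot := (fun p => _) in pr.
pose w : C := cexp (Complex 0 th).
have wre : Re w = cos th by rewrite Re_cexp /= expR0 mul1r.
have wim : Im w = sin th by rewrite Im_cexp /= expR0 mul1r.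
have toC_rot (p : plane) : toC (rot p) = w * toC p.
  by apply: complex_ext; rewrite 1?[RHS]Re_mul 1?[RHS]Im_mul wre wim /=; ring.
have sqn_rot (p : plane) : sqn (rot p) = sqn p.
  by rewrite /sqn toC_rot abs2M abs2_cexp mul0rn expR0 mul1r.
have wjk : w ^+ j * conjc w ^+ k = Complex 0 1.
  rewrite cexp_conj -!cexp_natl -cexpD.
  have -> : j%:R * Complex 0 th + k%:R * conjc (Complex 0 th) = Complex 0 (pi / 2).
    apply: complex_ext; rewrite ?(Re_add, Im_add, Re_mul, Im_mul) !(Re_natr, Im_natr) /=.
      by ring.
    by rewrite /th; move: (pi : R) => P; field.
  by apply: complex_ext; rewrite ?Re_cexp ?Im_cexp /= expR0 ?cos_pihalf ?sin_pihalf mul1r.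
have mF : cmeas (fun p : plane => h p * (toC p ^+ j * conjc (toC p) ^+ k)).
  exact: cintegrable_cmeas (cintegrable_mixed j k s00 dh).
have := cint_preserves pr mF; rewrite -/(mixed_moment h j k).
have -> : (fun p : plane => h (rot p) * (toC (rot p) ^+ j * conjc (toC (rot p)) ^+ k)) =
  (fun p : plane => Complex 0 1 * (h p * (toC p ^+ j * conjc (toC p) ^+ k))).
  apply/funext => p; rewrite toC_rot (rh _ _ (sqn_rot p)) -wjk rmorphM !exprMn /=.
  by ring.
rewrite cintZ; last exact: cintegrable_mixed s00 dh.
rewrite -/(mixed_moment h j k) => E.
have : (1 - Complex 0 1) * mixed_moment h j k = 0 by rewrite mulrBl E mul1r subrr.
move=> /eqP; rewrite mulf_eq0 => /orP[|/eqP//].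
by rewrite eq_complex /= subr0 oner_eq0.
Qed.

Lemma mixed_momentE h n : mixed_moment h n n = moment h n 0.
Proof.
congr cint; apply/funext => p; rewrite oppr0 mul0r cexp0 mulr1; congr (_ * _).
rewrite -exprMn rmorphXn /=; congr (_ ^+ _); case: p => x y.
by apply: complex_ext; rewrite ?Re_mul ?Im_mul /sqn /abs2 /=; ring.
Qed.

(** The normalization factor of [u_n]. *)
Let invsqrt (n : nat) : C := ((Num.sqrt (n`!%:R : R))%:C)^-1.

Lemma bargmann_series phi n z : L2 phi ->
  cintegrable mu2 (weighted (fun w => cexp (z * conjc w) * (phi w * basis_u n w))) /\
  ccvg (fun N => \sum_(k < N)
      invsqrt n * z ^+ k * mixed_moment (weighted phi) n k / k`!%:R)
    (bargmann (fun w => phi w * basis_u n w) z).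
Proof.
move=> L2phi; have dh := expdecay_weighted L2phi.
have s00 : - (1 / 2) < 0 :> R by lra.
pose h := weighted phi.
pose zeta (p : plane) : C := z * conjc (toC p).
pose H (p : plane) : C := invsqrt n * (h p * toC p ^+ n).
have HE : weighted (fun w => cexp (z * conjc w) * (phi w * basis_u n w)) =
    (fun p => H p * cexp (zeta p)).
  apply/funext => p.
  by rewrite /weighted /H /h /weighted /basis_u -/(invsqrt n) /zeta; ring.
rewrite /bargmann integral_muE HE.
have [g ig hg] := dominated_growth n s00 dh (mulr_ge0 (ler0n R 4) (normc_ge0 z)).
have [] := @cint_exp_series _ _ _ mu2 H zeta (fun p => normc (invsqrt n) * g p).
- apply: cmeasM; first exact: cmeas_cst.
  by apply: cmeasM; [exact: dh.1|apply: cmeasX; exact: cmeas_toC].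
- by apply: cmeasM; [exact: cmeas_cst|apply: cmeas_conj; exact: cmeas_toC].
- by have := integrableZl measurableT (normc (invsqrt n)) ig.
- move=> p; rewrite /H normcM normcM normcX.
  rewrite -mulrA ler_wpM2l ?normc_ge0//.
  apply: le_trans (hg p); rewrite ler_wpM2l ?mulr_ge0 ?exprn_ge0 ?normc_ge0//.
  have zn : normc (zeta p) = normc z * normc (toC p).
    by rewrite /zeta normcM normc_conj.
  rewrite ler_expR -mulrA -zn /norm1.
  by have := norm_Re_le (zeta p); have := norm_Im_le (zeta p); lra.
move=> _ iH SL; split => //.
congr ccvg: SL; apply/funext => N; apply: eq_bigr => k _; congr (_ / _).
rewrite /mixed_moment -cintZ; last exact: cintegrable_mixed s00 dh.
by congr cint; apply/funext => p; rewrite /H /h /zeta exprMn; ring.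
Qed.

(** Of the series in [bargmann_series] only the term [k = n] survives. *)
Lemma bargmann_radial phi n z : L2 phi -> radial phi ->
  bargmann (fun w => phi w * basis_u n w) z =
  moment (weighted phi) n 0 / n`!%:R * basis_u n z.
Proof.
move=> L2phi rphi; have dh := expdecay_weighted L2phi.
have s00 : - (1 / 2) < 0 :> R by lra.
have rh := rot_invariant_weighted rphi.
have [_] := bargmann_series n z L2phi; set S := (fun N => _) => SL.
apply: (ccvg_unique SL).
have stable N : (n < N)%N ->
    S N = moment (weighted phi) n 0 / n`!%:R * basis_u n z.
  move=> nN; rewrite /S (bigD1 (Ordinal nN))//= big1 => [|k kn]; last first.
    by rewrite (mixed_moment_eq0 s00 dh rh) ?mulr0 ?mul0r// eq_sym.
  by rewrite addr0 mixed_momentE /basis_u -/(invsqrt n); ring.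
apply: cvg_near_cst; exists n.+1 => // N /= nN.
by rewrite stable// subrr normc_real normr0.
Qed.

Lemma bargmann_span phi (c : nat -> C) n z : L2 phi ->
  bargmann (fun w => phi w * \sum_(k < n) c k * basis_u k w) z =
  \sum_(k < n) c k * bargmann (fun w => phi w * basis_u k w) z.
Proof.
move=> L2phi; rewrite /bargmann integral_muE.
pose F k := weighted (fun w => cexp (z * conjc w) * (phi w * basis_u k w)).
have iF k : cintegrable mu2 (F k) := (bargmann_series k z L2phi).1.
transitivity (cint mu2 (fun p => \sum_(k < n) c k * F k p)).
  congr cint; apply/funext => p; rewrite /F /weighted !mulr_sumr mulr_suml.
  by apply: eq_bigr => k _; ring.
rewrite (@cint_sum _ _ _ mu2 (fun k p => c k * F k p)).
  by apply: eq_bigr => k _; rewrite cintZ// integral_muE.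
by move=> k; exact: cintegrableZ.
Qed.

End Eigen.

(** * The symbols gamma and the span of the monomials *)

Section Symbols.
Context {R : realType}.
Local Notation C := (complex R).
Local Notation mu2 := (@lebesgue_measure R \x @lebesgue_measure R)%E.
Local Notation plane := (measurableTypeR R * measurableTypeR R)%type.

Lemma cmeasurable_gamma (a : C) : cmeasurable (gamma a).
Proof.
apply: (@cmeasM _ _ _ (fun=> a) (fun p : plane => cexp ((1 - a) * (sqn p)%:C))).
  exact: cmeas_cst.
apply: cmeas_cexp; apply: cmeasM; first exact: cmeas_cst.
by apply: cmeas_real; exact: measurable_sqn.
Qed.

Lemma radial_gamma (a : C) : radial (gamma a).
Proof.
move=> z w; rewrite !normc_def => /complexI zw; rewrite /gamma.
have -> // : abs2 z = abs2 w.
by rewrite -[LHS]normc_sqr -[RHS]normc_sqr !normcE /abs2 zw.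
Qed.

Lemma cmeasurable_basis n : cmeasurable (@basis_u R n).
Proof.
apply: (@cmeasM _ _ _ (fun p : plane => toC p ^+ n)); last exact: cmeas_cst.
by apply: cmeasX; exact: cmeas_toC.
Qed.

Lemma cmeasurableM (f g : C -> C) : cmeasurable f -> cmeasurable g ->
  cmeasurable (fun w => f w * g w).
Proof. by move=> mf mg; exact: (@cmeasM _ _ _ (fun p : plane => f (toC p))). Qed.

Lemma L2D (f g : C -> C) : L2 f -> L2 g -> L2 (fun w => f w + g w).
Proof.
move=> L2f L2g; have mfg : cmeasurable (fun w => f w + g w).
  exact: (cmeasD L2f.1 L2g.1).
apply/(L2P mfg); have i1 := (L2P L2f.1).1 L2f; have i2 := (L2P L2g.1).1 L2g.
have i12 := integrableZl measurableT 2 (integrableD measurableT i1 i2).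
apply: (@integrable_dom _ _ _ mu2 _ (fun p => 2 * (abs2 (f (toC p)) * gauss p +
   abs2 (g (toC p)) * gauss p))).
- apply: measurable_funM; last exact: measurable_gauss.
  exact: (@measurable_abs2 _ _ _ (fun p => f (toC p) + g (toC p))).
- exact: i12.
move=> p; rewrite (ger0_norm (mulr_ge0 (abs2_ge0 _) (gauss_ge0 _))).
rewrite -mulrDl mulrA ler_wpM2r ?gauss_ge0// /abs2 Re_add Im_add.
set x := Re _; set y := Re _; set u := Im _; set v := Im _.
rewrite -subr_ge0.
have -> : 2 * (x ^+ 2 + u ^+ 2 + (y ^+ 2 + v ^+ 2)) - ((x + y) ^+ 2 + (u + v) ^+ 2) =
  (x - y) ^+ 2 + (u - v) ^+ 2 by ring.
by rewrite addr_ge0 ?sqr_ge0.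
Qed.

(** The squared modulus of [gamma a] times the Gaussian weight is a multiple of
    [e^((1 - 2 Re a) t)]: this is where the condition [1 / 2 < Re a] enters. *)
Lemma L2_gamma_basis (a : C) (c : C) n : 1 / 2 < Re a ->
  L2 (fun w => gamma a w * (c * basis_u n w)).
Proof.
move=> a2; have m : cmeasurable (fun w => gamma a w * (c * basis_u n w)).
  apply: cmeasurableM; first exact: cmeasurable_gamma.
  apply: (@cmeasurableM (fun=> c)); first exact: cmeas_cst.
  exact: cmeasurable_basis.
apply/(L2P m); have s0 : 0 < 2 * Re a - 1 by lra.
pose K : R := abs2 a * abs2 c / n`!%:R * pi^-1.
have -> : EFin \o (fun p => abs2 (gamma a (toC p) * (c * basis_u n (toC p))) * gauss p) =
   EFin \o (fun p : plane => K * (sqn p ^+ n * expR (- ((2 * Re a - 1) * sqn p)))).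
  apply/funext => p /=; congr _%:E.
  rewrite abs2M abs2M /gamma abs2M abs2_cexp Re_mulr_real Re_add Re_opp.
  rewrite /basis_u abs2M abs2X -fmorphV abs2_real exprVn sqr_sqrtr//.
  rewrite gaussE /K -/(sqn p).
  have -> : expR (- ((2 * Re a - 1) * sqn p)) =
     expR ((Re (1 : C) - Re a) * sqn p *+ 2) * expR (- (1 * sqn p)).
    by rewrite -expRD; congr expR; rewrite -mulr_natr /=; ring.
  by rewrite -/(sqn p); ring.
by have := integrableZl measurableT K (integrable_sqn_gauss n s0).
Qed.

Lemma L2_gamma_span (a : C) (c : nat -> C) n : 1 / 2 < Re a ->
  L2 (fun w => gamma a w * \sum_(k < n) c k * basis_u k w).
Proof.
move=> a2; elim: n => [|n IH].
  have := L2_gamma_basis 0 0 a2; congr L2; apply/funext => w.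
  by rewrite big_ord0 mul0r.
have := L2D IH (L2_gamma_basis (c n) n a2); congr L2; apply/funext => w.
by rewrite big_ord_recr mulrDr.
Qed.

Lemma gamma1 (w : C) : gamma 1 w = 1.
Proof. by rewrite /gamma subrr mul0r cexp0 mulr1. Qed.

Lemma L2_span (c : nat -> C) n : L2 (fun w => \sum_(k < n) c k * basis_u k w).
Proof.
have a2 : 1 / 2 < Re (1 : C) by rewrite /=; lra.
have := L2_gamma_span c n a2; congr L2; apply/funext => w.
by rewrite gamma1 mul1r.
Qed.

Lemma L2_gamma (a : C) : 1 / 2 < Re a -> L2 (gamma a).
Proof.
move=> a2; have := L2_gamma_basis 1 0 a2; congr L2; apply/funext => w.
by rewrite /basis_u expr0 fact0 sqrtr1 divr1 !mulr1.
Qed.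

Lemma entire_span (c : nat -> C) n :
  entire (fun w => \sum_(k < n) c k * basis_u k w).
Proof.
move=> z; elim: n => [|n IH].
  have -> : (fun w : C => \sum_(k < 0) c k * basis_u k w) = cst 0.
    by apply/funext => w; rewrite big_ord0.
  exact: derivable_cst.
have -> : (fun w : C^o => \sum_(k < n.+1) c k * basis_u k w) =
  ((fun w : C^o => \sum_(k < n) c k * basis_u k w) : C^o -> C^o) +
  ((c n / (Num.sqrt (n`!%:R : R))%:C) \*: ((@id C^o) ^+ n)).
  apply/funext => w; rewrite big_ord_recr !fctE; congr (_ + _).
  by rewrite /basis_u mulrA; exact: mulrAC.
apply: derivableD; first exact: IH.
by apply: derivableZ; apply: derivableX; exact: derivable_id.
Qed.

Lemma F2_span (c : nat -> C) n : F2 (fun w => \sum_(k < n) c k * basis_u k w).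
Proof. by split; [exact: entire_span|exact: L2_span]. Qed.

Lemma basis_u_span n : @basis_u R n =
  (fun w => \sum_(k < n.+1) (if k == n :> nat then 1 else 0) * basis_u k w).
Proof.
apply/funext => w; rewrite big_ord_recr /= eqxx mul1r big1 ?add0r// => k _.
by rewrite ltn_eqF// mul0r.
Qed.

Definition gaussC (p : plane) : C := (gauss p)%:C.

Lemma expdecay_gauss : expdecay (- 1) gaussC.
Proof.
split; first by apply: cmeas_real; exact: measurable_gauss.
move=> s s1; have s0 : 0 < 1 + s by lra.
have := integrableZl measurableT pi^-1 (integrable_gauss s0).
have E p : normc (gaussC p) = pi^-1 * expR (- (1 * sqn p)).
  by rewrite /gaussC normc_real (ger0_norm (gauss_ge0 p)) gaussE.
apply: eq_integrable => // p _; rewrite -[RHS]/((normc (gaussC p) * expR (- (s * sqn p)))%:E) E /=.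
by rewrite -EFinM -mulrA -expRD; congr (_ * expR _)%:E; ring.
Qed.

Lemma moment_gauss n : moment gaussC n 0 = n`!%:R.
Proof.
have E : (fun p : plane => gaussC p * (sqn p ^+ n)%:C * cexp (- 0 * (sqn p)%:C)) =
   (fun p => (pi^-1 * (sqn p ^+ n * expR (- (1 * sqn p))))%:C).
  apply/funext => p; rewrite oppr0 mul0r cexp0 mulr1 /gaussC gaussE -rmorphM.
  by congr _%:C; ring.
rewrite /moment E; apply: complex_ext; rewrite ?Re_natr ?Im_natr /=; last first.
  by rewrite Rintegral_cst// mul0r.
rewrite RintegralZl//; last exact: integrable_sqn_gauss.
rewrite -/(gauss_moment n 1) gauss_momentE// expr1n divr1 mulrA mulVf ?mul1r//.
by rewrite gt_eqF ?pi_gt0.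
Qed.

(** In the variable [t] the Gaussian measure is [e^(-t) dt], the case [c = 1].  At
    [s = 0] the recurrence is the one of the factorials. *)
Lemma moment_rec_gauss (s : C) : -1 < Re s -> moment_rec 1 gaussC s.
Proof.
move=> s1; apply: (moment_rec_propagate _ expdecay_gauss s1); first by lra.
move=> n; rewrite addr0 mul1r !moment_gauss; case: n => [|n] /=.
  by rewrite mul0r add0r fact0.
by rewrite addr0 factS natrM.
Qed.

(** Multiplying by [gamma a] shifts the Laplace variable by [a - 1], up to the
    factor [a]. *)
Lemma moment_rec_gamma (a s : C) : 1 / 2 < Re a -> - (1 / 2) < Re s ->
  moment_rec a (weighted (gamma a)) s.
Proof.
move=> a2 s2.
have as1 : -1 < Re (a - 1 + s) by rewrite !Re_add Re_opp /=; lra.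
have E n : moment (weighted (gamma a)) n s = a * moment gaussC n (a - 1 + s).
  rewrite /moment -cintZ; last exact: cintegrable_moment expdecay_gauss as1.
  congr cint; apply/funext => p; rewrite /weighted /gamma -/(gaussC p) -/(sqn p).
  have -> : - (a - 1 + s) * (sqn p)%:C = (1 - a) * (sqn p)%:C + - s * (sqn p)%:C.
    by ring.
  by rewrite cexpD; ring.
move=> n; have := moment_rec_gauss as1 n; rewrite !E.
have -> : 1 + (a - 1 + s) = a + s by ring.
move=> H; rewrite mulrCA H mulrDr; congr (_ + _); first by ring.
by case: ifP; rewrite ?mulr1 ?mulr0.
Qed.

Lemma moment_of_rec (c : C) h : c != 0 -> moment_rec c h 0 ->
  forall n, moment h n 0 = n`!%:R * c ^- n.
Proof.
move=> c0 H; elim=> [|n IH]; apply: (mulfI c0).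
  have := H 0%N; rewrite addr0 /= mul0r add0r => ->.
  by rewrite fact0 expr0 invr1 !mulr1.
have := H n.+1; rewrite addr0 /= addr0 IH => ->.
by rewrite factS natrM exprS; field; rewrite c0 expf_neq0.
Qed.

Lemma rec_of_moment (c : C) h : c != 0 ->
  (forall n, moment h n 0 = n`!%:R * c ^- n) -> moment_rec c h 0.
Proof.
move=> c0 H n; rewrite addr0 !H; case: n => [|n] /=.
  by rewrite mul0r add0r fact0 expr0 invr1 !mulr1.
by rewrite addr0 factS natrM exprS; field; rewrite c0 expf_neq0.
Qed.

Lemma toeplitz_gamma_span (a : C) (c : nat -> C) n : 1 / 2 < Re a ->
  bargmann (fun w => gamma a w * \sum_(k < n) c k * basis_u k w) =
  (fun z => \sum_(k < n) (c k * a ^- k) * basis_u k z).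
Proof.
move=> a2; have L2a := L2_gamma a2; apply/funext => z.
have a0 : a != 0 by apply: contraL a2 => /eqP ->; rewrite /= -leNgt; lra.
have re : moment_rec a (weighted (gamma a)) 0 by apply: moment_rec_gamma => //=; lra.
rewrite bargmann_span//; apply: eq_bigr => k _.
rewrite bargmann_radial//; last exact: radial_gamma.
by rewrite (moment_of_rec a0 re); field; rewrite expf_neq0// natr_fact_neq0.
Qed.

End Symbols.

(** * The half-plane condition is necessary *)

Section Converse.
Context {R : realType}.
Local Notation C := (complex R).
Local Notation mu2 := (@lebesgue_measure R \x @lebesgue_measure R)%E.

(** A form of the Cauchy-Schwarz inequality: with weights [e^-1] and [e], the
    modulus of [phi] times [e^(- Re s t)] is at most half the weighted sum of the
    squares; the square of [e^(- Re s t)] times the Gaussian weight is at most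
    [e^(-2 e^2 t) / pi], whose integral over the plane is [1 / (2 e^2)]. *)
Lemma laplace_bound (phi : C -> C) (s : C) (e : R) : L2 phi -> 0 < e ->
  - (1 / 2) + e ^+ 2 <= Re s ->
  e ^+ 2 * normc (moment (weighted phi) 0 s) <=
  e * (\int[mu2]_p (abs2 (phi (toC p)) * gauss p) + 1 / 2).
Proof.
move=> L2phi e0 es.
have i1 := (L2P L2phi.1).1 L2phi.
have e20 : 0 < 2 * e ^+ 2 by rewrite mulr_gt0 ?exprn_gt0.
have i2 := integrable_gauss e20.
have iA := integrableZl measurableT (e^-1 / 2) i1.
have iB := integrableZl measurableT (e / 2 * pi^-1) i2.
have iAB := integrableD measurableT iA iB.
pose g p : R := e^-1 / 2 * (abs2 (phi (toC p)) * gauss p) +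
   e / 2 * pi^-1 * expR (- (2 * e ^+ 2 * sqn p)).
have Hs : - (1 / 2) < Re s by have := exprn_gt0 2 e0; lra.
have iF := cintegrable_moment 0 (expdecay_weighted L2phi) Hs.
have bnd p : normc (weighted phi p * (sqn p ^+ 0)%:C * cexp (- s * (sqn p)%:C)) <= g p.
  rewrite normc_moment expr0 mulr1 /weighted normcM normc_real.
  rewrite (ger0_norm (gauss_ge0 p)) /g -normc_sqr gaussE.
  set N := normc _.
  have -> : expR (- (2 * e ^+ 2 * sqn p)) =
     expR (- (1 * sqn p)) * expR ((1 / 2 - e ^+ 2) * sqn p) ^+ 2.
    by rewrite -expRM_natl -expRD; congr expR; field.
  set G := expR (- (1 * _)); set E := expR ((_ - _) * _).
  have EE : expR (- (Re s * sqn p)) <= E.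
    by rewrite ler_expR -mulNr ler_wpM2r ?sqn_ge0//; lra.
  have N0 : 0 <= N by exact: normc_ge0.
  have P0 : 0 <= pi^-1 * G by rewrite mulr_ge0 ?expR_ge0// invr_ge0 pi_ge0.
  apply: (le_trans (ler_wpM2l _ EE)); first by rewrite mulr_ge0.
  have -> : e / 2 * pi^-1 * (G * E ^+ 2) = e / 2 * (pi^-1 * G) * E ^+ 2 by rewrite !mulrA.
  move: (pi^-1 * G) P0 => P P0; rewrite -subr_ge0.
  have -> : e^-1 / 2 * (N ^+ 2 * P) + e / 2 * P * E ^+ 2 - N * P * E =
     P * (e / 2) * (N / e - E) ^+ 2 by field; rewrite gt_eqF.
  by rewrite mulr_ge0 ?sqr_ge0// mulr_ge0// divr_ge0// ltW.
have ig : mu2.-integrable setT (EFin \o g) by exact: iAB.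
have := normc_cint iF ig bnd; rewrite -/(moment (weighted phi) 0 s) => h.
have gI : \int[mu2]_p g p = e^-1 / 2 * \int[mu2]_p (abs2 (phi (toC p)) * gauss p) +
    e / 2 * (2 * e ^+ 2)^-1.
  rewrite /g RintegralD//.
  rewrite RintegralZl// RintegralZl//; congr (_ + _).
  have -> : \int[mu2]_p expR (- (2 * e ^+ 2 * sqn p)) = gauss_moment 0 (2 * e ^+ 2).
    by apply: eq_Rintegral => p _; rewrite expr0 mul1r.
  rewrite gauss_momentE// fact0 expr1 mulr1 -mulrA; congr (_ * _).
  by rewrite mulrA mulVf ?mul1r// gt_eqF ?pi_gt0.
have e2 : 0 <= e ^+ 2 by rewrite sqr_ge0.
apply: le_trans (ler_wpM2l e2 h) _; rewrite gI le_eqVlt; apply/orP; left.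
by apply/eqP; field; rewrite gt_eqF.
Qed.

Lemma Re_gt_half (phi : C -> C) (c : C) : L2 phi -> c != 0 ->
  moment_rec c (weighted phi) 0 -> 1 / 2 < Re c.
Proof.
move=> L2phi c0 H0; rewrite ltNge; apply/negP => c2.
pose A := \int[mu2]_p (abs2 (phi (toC p)) * gauss p).
have A0 : 0 <= A.
  by apply: Rintegral_ge0 => p _; rewrite mulr_ge0 ?abs2_ge0// gauss_ge0.
have nc0 : 0 < normc c.
  rewrite lt_neqAle normc_ge0 andbT eq_sym; apply: contra c0 => /eqP h.
  by apply/eqP; exact: eq0_normc.
have bound e : 0 < e -> normc c <= e * (A + 1 / 2).
  move=> e0; pose s : C := - c + (e ^+ 2)%:C.
  have e2 : 0 < e ^+ 2 by rewrite exprn_gt0.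
  have es : - (1 / 2) + e ^+ 2 <= Re s by rewrite Re_add Re_opp /= lerD2r lerN2.
  have s2 : - (1 / 2) < Re s by lra.
  have half : - (1 / 2) < 0 :> R by lra.
  have := moment_rec_propagate half (expdecay_weighted L2phi) s2 H0.
  move=> /(_ 0%N) /=; rewrite mul0r add0r /s addrA subrr add0r => E.
  rewrite -E normcM normc_real (ger0_norm (ltW e2)).
  exact: laplace_bound.
have A2 : 0 < A + 1 / 2 by lra.
have d0 : 0 < normc c / (2 * (A + 1 / 2)) by rewrite divr_gt0// mulr_gt0.
have := bound _ d0.
have -> : normc c / (2 * (A + 1 / 2)) * (A + 1 / 2) = normc c / 2.
  by move: A2; set B := A + _ => A2; field; rewrite gt_eqF.
lra.
Qed.

End Converse.

(** * Radial functions are determined by their Laplace integrals *)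

Section Uniqueness.
Context {R : realType}.
Local Notation C := (complex R).
Local Notation mu2 := (@lebesgue_measure R \x @lebesgue_measure R)%E.
Local Notation plane := (measurableTypeR R * measurableTypeR R)%type.

Section RadialLaplace.
Variable f : plane -> R.
Hypothesis intf : mu2.-integrable setT (EFin \o f).
Hypothesis radf : forall p p', sqn p = sqn p' -> f p = f p'.
Hypothesis laplace0 : forall s, 0 <= s ->
  \int[mu2]_p (f p * expR (- (s * sqn p))) = 0.

Let mf : measurable_fun setT f.
Proof. by apply/measurable_EFinP; exact: measurable_int intf. Qed.

Lemma integrable_mul_bounded (g : plane -> R) : measurable_fun setT g ->
  (forall p, `|g p| <= 1) ->
  mu2.-integrable setT (EFin \o (fun p => f p * g p)).
Proof.
move=> mg g1; apply: (@integrable_dom _ _ _ mu2 _ (fun p => `|f p|)).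
- exact: measurable_funM.
- exact: integrable_norm.
- by move=> p; rewrite normrM ler_piMr.
Qed.

Lemma exp_le1 (s : R) (p : plane) : 0 <= s -> expR (- (s * sqn p)) <= 1.
Proof. by move=> s0; rewrite expR_le1 oppr_le0 mulr_ge0 ?sqn_ge0. Qed.

Lemma one_sub_exp_ge0 (s : R) (p : plane) : 0 <= s -> 0 <= 1 - expR (- (s * sqn p)) <= 1.
Proof.
move=> s0; rewrite subr_ge0 exp_le1//= lerBlDr lerDl expR_ge0//.
Qed.

Lemma measurable_step (s : R) m :
  measurable_fun [set: plane] (fun p => (1 - expR (- (s * sqn p))) ^+ m).
Proof.
by apply: measurable_funX; apply: measurable_funB => //; exact: measurable_exp_sqn.
Qed.

Lemma step_bound (s : R) m p : 0 <= s -> `|(1 - expR (- (s * sqn p))) ^+ m| <= 1.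
Proof.
move=> s0; have /andP[a0 a1] := one_sub_exp_ge0 p s0.
by rewrite normrX ger0_norm// exprn_ile1.
Qed.

(** The product is a linear combination of exponentials.  The induction on [m]
    needs an extra exponential factor. *)
Lemma laplace_poly0 (s : R) m : 0 <= s ->
  \int[mu2]_p (f p * (1 - expR (- (s * sqn p))) ^+ m) = 0.
Proof.
move=> s0.
suff main r : 0 <= r ->
    \int[mu2]_p (f p * (expR (- (r * sqn p)) * (1 - expR (- (s * sqn p))) ^+ m)) = 0.
  rewrite -[RHS](main 0)//; apply: eq_Rintegral => p _.
  by rewrite mul0r oppr0 expR0 mul1r.
have ib r' m' : 0 <= r' -> mu2.-integrable setT (EFin \o (fun p =>
    f p * (expR (- (r' * sqn p)) * (1 - expR (- (s * sqn p))) ^+ m'))).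
  move=> r0; apply: integrable_mul_bounded => [|p].
    by apply: measurable_funM; [exact: measurable_exp_sqn|exact: measurable_step].
  by rewrite normrM mulr_ile1 ?step_bound// ger0_norm ?expR_ge0// exp_le1.
elim: m r => [|m IH] r r0.
  by rewrite -[RHS](laplace0 r0); apply: eq_Rintegral => p _; rewrite expr0 mulr1.
have rs0 : 0 <= r + s by rewrite addr_ge0.
transitivity (\int[mu2]_p
  (f p * (expR (- (r * sqn p)) * (1 - expR (- (s * sqn p))) ^+ m) -
   f p * (expR (- ((r + s) * sqn p)) * (1 - expR (- (s * sqn p))) ^+ m))).
  apply: eq_Rintegral => p _; rewrite mulrDl opprD expRD exprS; ring.
by rewrite RintegralB ?IH ?subr0//; exact: ib.
Qed.

(** Dominated convergence: steps with values in the unit interval are dominated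
    by 1. *)
Lemma laplace_limit (q : nat -> plane -> R) (A : set R) : measurable A ->
  (forall n, exists2 s, 0 <= s & exists m, q n = fun p => (1 - expR (- (s * sqn p))) ^+ m) ->
  (forall p, (q ^~ p) @ \oo --> (\1_A (sqn p) : R)) ->
  \int[mu2]_p (f p * \1_A (sqn p)) = 0.
Proof.
move=> mA Hq qA.
have [||||_ L] := @Rintegral_dct _ _ _ mu2 (fun n p => f p * q n p)
  (fun p => f p * \1_A (sqn p)) (fun p => `|f p|).
- move=> n; have [s s0 [m ->]] := Hq n; apply: measurable_funM => //.
  exact: measurable_step.
- by move=> p; apply: cvgMr; exact: qA.
- exact: integrable_norm.
- move=> n p; have [s s0 [m ->]] := Hq n.
  by rewrite normrM ler_piMr// step_bound.
have E : (fun n => \int[mu2]_p (f p * q n p)) = (fun=> 0).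
  by apply/funext => n; have [s s0 [m ->]] := Hq n; exact: laplace_poly0.
by rewrite E in L; rewrite -(cvg_lim _ L)// lim_cst.
Qed.

(** With [y = e^(-s t)] and [s = ln 2 / th], the sequence [(1 - y^n)^(n 2^n)] tends
    to the indicator of [y < 1/2], that is, of [th < t].  Bernoulli's inequality
    bounds it from below by [1 - n (2 y)^n], and from above by
    [1 / (1 + y^n)^(n 2^n) <= 1 / (n (2 y)^n)].  The extra factor [n] in the
    exponent forces the limit 0 at the threshold [y = 1/2] as well, so that the
    convergence holds everywhere. *)
Lemma integral_ray_gt0 (th : R) : 0 < th ->
  \int[mu2]_p (f p * \1_(`]th, +oo[%classic) (sqn p)) = 0.
Proof.
move=> th0; pose s := ln 2 / th.
have ln2 : 0 < ln 2 :> R by rewrite ln_gt0// ltr1n.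
have s0 : 0 < s by rewrite divr_gt0.
pose M n := (n.+1 * 2 ^ n.+1)%N.
apply: (@laplace_limit (fun n p => (1 - expR (- (n.+1%:R * s * sqn p))) ^+ M n)).
- exact: measurable_itv.
- by move=> n; exists (n.+1%:R * s); [rewrite mulr_ge0// ltW|exists (M n)].
move=> p; rewrite indicE; have t0 := sqn_ge0 p; set t := sqn p in t0 *.
have M2 n : (M n)%:R = n.+1%:R * expR (n.+1%:R * ln 2) :> R.
  by rewrite expRM_natl lnK ?posrE// /M natrM natrX.
have M0 n : 0 < (M n)%:R :> R by rewrite M2 mulr_gt0 ?expR_gt0.
have y0 n : 0 < expR (- (n.+1%:R * s * t)) by rewrite expR_gt0.
have y1 n : expR (- (n.+1%:R * s * t)) <= 1.
  by apply: exp_le1; rewrite mulr_ge0// ltW.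
have My n : (M n)%:R * expR (- (n.+1%:R * s * t)) =
    n.+1%:R * expR (- (n.+1%:R * (s * t - ln 2))).
  by rewrite M2 -mulrA -expRD; congr (_ * expR _); ring.
have [tht|tht] := ltP th t.
  rewrite mem_set /=; last by rewrite in_itv /= andbT.
  pose a := s * t - ln 2.
  have a0 : 0 < a.
    by rewrite subr_gt0 /s mulrAC ltr_pdivlMr// ltr_pM2l.
  apply: (@squeeze_cvgr _ _ _ _ (fun n => 1 - 2 / a ^+ 2 * harmonic n) (fun=> 1)).
  - apply: nearW => n; apply/andP; split; last first.
      by rewrite exprn_ile1 ?subr_ge0// lerBlDr lerDl ltW.
    have := @bernoulli _ (- expR (- (n.+1%:R * s * t))) (M n).
    rewrite lerN2 y1 mulrN My -/a => /(_ isT); apply: le_trans.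
    rewrite lerD2l lerN2 expRN.
    have na0 : 0 < n.+1%:R * a by rewrite mulr_gt0.
    have := expR_ge1Dxn 1 (ltW na0); rewrite (_ : 2`! = 2)%N// => h.
    have h2 : (n.+1%:R * a) ^+ 2 / 2 <= expR (n.+1%:R * a).
      by rewrite (le_trans _ h)// lerDr.
    rewrite ler_pdivrMr ?expR_gt0//.
    apply: le_trans (ler_wpM2l _ h2); last first.
      by rewrite mulr_ge0 ?harmonic_ge0// divr_ge0// sqr_ge0.
    rewrite /harmonic /= le_eqVlt; apply/orP; left; apply/eqP.
    have N0 : n.+1%:R != 0 :> R by rewrite pnatr_eq0.
    by move: (n.+1%:R) N0 => N N0; field; rewrite N0 gt_eqF.
  - rewrite -[X in _ --> X]subr0 -(mulr0 (2 / a ^+ 2)).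
    by apply: cvgB; [exact: cvg_cst|apply: cvgMr; exact: cvg_harmonic].
  - exact: cvg_cst.
rewrite memNset /=; last by rewrite in_itv /= andbT; apply/negP; rewrite -leNgt.
apply: (@squeeze_cvgr _ _ _ _ (fun=> 0) harmonic).
- apply: nearW => n; rewrite exprn_ge0 ?subr_ge0//=.
  have := y1 n; have := y0 n; set y := expR _ => {}y0 {}y1.
  have st : s * t <= ln 2 by rewrite /s mulrAC ler_pdivrMr// ler_pM2l.
  have yN : 1 <= expR (n.+1%:R * ln 2) * y.
    rewrite -expRD (le_trans _ (expR_ge1Dx _))// lerDl.
    have -> : n.+1%:R * ln 2 + - (n.+1%:R * s * t) = n.+1%:R * (ln 2 - s * t) by ring.
    by rewrite mulr_ge0// subr_ge0.
  have Ny : n.+1%:R <= (M n)%:R * y by rewrite M2 -mulrA ler_peMr.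
  have b := @bernoulli _ y (M n) _.
  have yy : 0 <= y by rewrite ltW.
  rewrite /harmonic -[leRHS]mul1r ler_pdivlMr//.
  apply: (@le_trans _ _ ((1 - y) ^+ M n * (1 + y) ^+ M n)).
    rewrite ler_wpM2l ?exprn_ge0 ?subr_ge0//.
    rewrite (le_trans Ny)// (le_trans _ (b _))//; first by rewrite lerDr.
    by rewrite (le_trans _ yy).
  rewrite -exprMn exprn_ile1//.
    by rewrite mulr_ge0 ?subr_ge0// addr_ge0.
  have -> : (1 - y) * (1 + y) = 1 - y ^+ 2 by ring.
  by rewrite lerBlDr lerDl sqr_ge0.
- exact: cvg_cst.
- exact: cvg_harmonic.
Qed.

Lemma integral_ray0 : \int[mu2]_p (f p * \1_(`]0, +oo[%classic) (sqn p)) = 0.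
Proof.
apply: (@laplace_limit (fun n p => (1 - expR (- (n%:R * sqn p))) ^+ 1)).
- exact: measurable_itv.
- by move=> n; exists n%:R => //; exists 1%N.
move=> p; rewrite indicE; have := sqn_ge0 p; set t := sqn p.
rewrite le_eqVlt => /predU1P[<-|t0].
  rewrite memNset /=; last by rewrite in_itv /= ltxx.
  by under eq_fun do rewrite mulr0 oppr0 expR0 subrr expr1; exact: cvg_cst.
rewrite mem_set /=; last by rewrite in_itv /= t0.
have -> : (fun n => (1 - expR (- (n%:R * t))) ^+ 1) = (fun n => 1 - (expR t)^-1 ^+ n).
  by apply/funext => n; rewrite expr1 expRN expRM_natl exprVn.
suff : (fun n => 1 - (expR t)^-1 ^+ n) @ \oo --> (1 - 0 : R) by rewrite subr0.
apply: cvgB; first exact: cvg_cst.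
apply: cvg_expr; rewrite ger0_norm ?invr_ge0 ?expR_ge0//.
by rewrite invf_lt1 ?expR_gt0// expR_gt1.
Qed.

Lemma integral_ray (th : R) : \int[mu2]_p (f p * \1_(`]th, +oo[%classic) (sqn p)) = 0.
Proof.
have [th0|th0|->] := ltgtP th 0; [|exact: integral_ray_gt0|exact: integral_ray0].
rewrite -[RHS](laplace0 (lexx 0)); apply: eq_Rintegral => p _.
rewrite mul0r oppr0 expR0 indicE mem_set//=.
by rewrite in_itv /= andbT (lt_le_trans th0)// sqn_ge0.
Qed.

Lemma measurable_ind (A : set R) : measurable A ->
  measurable_fun [set: plane] (fun p => \1_A (sqn p) : R).
Proof.
move=> mA; apply: (@measurableT_comp _ _ _ _ _ _ (\1_A : R -> R)).
  exact: measurable_indic.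
exact: measurable_sqn.
Qed.

Lemma ind_le1 (A : set R) (x : R) : `|\1_A x : R| <= 1.
Proof. by rewrite indicE; case: (_ \in _); rewrite ?normr1 ?normr0. Qed.

(** The sets for which the conclusion holds form a Dynkin system, and it contains
    the open rays, which generate the Borel sets. *)
Lemma integral_borel0 (A : set R) : measurable A ->
  \int[mu2]_p (f p * \1_A (sqn p)) = 0.
Proof.
pose P (A : set (measurableTypeR R)) := \int[mu2]_p (f p * \1_A (sqn p)) = 0.
have f0 : \int[mu2]_p f p = 0.
  rewrite -[RHS](laplace0 (lexx 0)); apply: eq_Rintegral => p _.
  by rewrite mul0r oppr0 expR0 mulr1.
move=> mA; apply: (@dynkin_induction _ (measurableTypeR R) (@RGenOInfty.G R) P).
- exact: RGenOInfty.measurableE.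
- move=> _ _ [x ->] [y ->]; exists (Num.max x y).
  by apply/seteqP; split => z /=; rewrite !in_itv /= !andbT gt_max => /andP.
- rewrite /P -[RHS]f0; apply: eq_Rintegral => p _.
  by rewrite indicE mem_set// mulr1.
- by move=> _ [x ->]; exact: integral_ray.
- move=> S mS PS; rewrite /P.
  transitivity (\int[mu2]_p (f p - f p * \1_S (sqn p))).
    apply: eq_Rintegral => p _; rewrite !indicE in_setC.
    by case: (_ \in _); rewrite /= ?mulr1 ?mulr0 ?subrr ?subr0.
  rewrite RintegralB//; first by rewrite f0 PS subrr.
  apply: integrable_mul_bounded; first exact: measurable_ind.
  by move=> p; exact: ind_le1.
- move=> F mF tF PF; rewrite /P.
  pose U n := \bigcup_(k < n) F k.
  have mU n : measurable (U n) by apply: bigcup_measurable.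
  have intU n : mu2.-integrable setT (EFin \o (fun p => f p * \1_(U n) (sqn p))).
    apply: integrable_mul_bounded; first exact: (measurable_ind (mU n)).
    by move=> p; exact: ind_le1.
  have intF n : mu2.-integrable setT (EFin \o (fun p => f p * \1_(F n) (sqn p))).
    apply: integrable_mul_bounded; first exact: (measurable_ind (mF n)).
    by move=> p; exact: ind_le1.
  have U0 n : \int[mu2]_p (f p * \1_(U n) (sqn p)) = 0.
    elim: n => [|n IH].
      transitivity (\int[mu2]_p (cst 0 p : R)); last by rewrite Rintegral_cst// mul0r.
      apply: eq_Rintegral => p _; rewrite indicE memNset ?mulr0//.
      by move=> [].
    transitivity (\int[mu2]_p (f p * \1_(U n) (sqn p) + f p * \1_(F n) (sqn p))).
      apply: eq_Rintegral => p _; rewrite -mulrDr; congr (_ * _); rewrite !indicE.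
      have [Fn|nFn] := pselect (F n (sqn p)).
        rewrite (mem_set Fn) mem_set; last by exists n => /=.
        rewrite memNset ?add0r// => -[k /= kn Fk].
        have E : k = n by apply: tF => //; exists (sqn p).
        by rewrite E ltnn in kn.
      rewrite (memNset nFn) addr0; congr (nat_of_bool _)%:R; apply/idP/idP => /set_mem.
        move=> [k /=]; rewrite ltnS leq_eqVlt => /predU1P[->//|kn Fk].
        by apply: mem_set; exists k.
      by move=> [k /= kn Fk]; apply: mem_set; exists k => //=; exact: ltnW.
    by rewrite RintegralD// IH PF addr0.
  have [||||_ L] := @Rintegral_dct _ _ _ mu2 (fun n p => f p * \1_(U n) (sqn p))
    (fun p => f p * \1_(\bigcup_k F k) (sqn p)) (fun p => `|f p|).
  + by move=> n; apply: measurable_funM => //; exact: (measurable_ind (mU n)).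
  + move=> p; apply: cvgMr; rewrite indicE.
    have [[k _ Fk]|nF] := pselect ((\bigcup_k F k) (sqn p)).
      rewrite mem_set; last by exists k.
      apply: cvg_near_cst; exists k.+1 => // n /= kn.
      by rewrite indicE mem_set//; exists k.
    rewrite memNset//; apply: cvg_near_cst; apply: nearW => n.
    by rewrite indicE memNset// => -[k _ Fk]; apply: nF; exists k.
  + exact: integrable_norm.
  + by move=> n p; rewrite normrM ler_piMr// ind_le1.
  rewrite (_ : (fun n => _) = (fun=> 0)) in L; last exact/funext.
  by rewrite -(cvg_lim _ L)// lim_cst.
- suff : (@RGenOInfty.G R).-sigma.-measurable A by [].
  by rewrite -RGenOInfty.measurableE.
Qed.

(** As [f] is a Borel function [G] of [sqn p], the sets where it is positive and
    where it is negative are of the form treated in [integral_borel0]; hence the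
    integral of the absolute value of [f] vanishes. *)
Lemma radial_laplace_ae0 : {ae mu2, forall p, f p = 0}.
Proof.
pose G (t : R) : R := f (Num.sqrt t, 0).
have fG p : f p = G (sqn p).
  apply: radf; rewrite /sqn /abs2 /= expr0n addr0 sqr_sqrtr//.
  exact: sqn_ge0.
have mG : measurable_fun [set: measurableTypeR R] G.
  apply: (@measurableT_comp _ _ _ _ _ _ f) => //.
  apply/measurable_fun_pairP; split => /=; last exact: measurable_cst.
  by apply: continuous_measurable_fun; exact: sqrt_continuous.
have ray_meas (H : R -> R) : measurable_fun [set: measurableTypeR R] H ->
    measurable ([set t | 0 < H t] : set (measurableTypeR R)).
  move=> mH; rewrite [X in measurable X](_ : _ = setT `&` H @^-1` `]0, +oo[%classic).
    by apply: mH => //; exact: measurable_itv.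
  by apply/seteqP; split => t /=; rewrite in_itv /= andbT; [|case].
have mGp := ray_meas _ mG.
have mGn := ray_meas _ (measurable_funN mG).
have intA (A : set (measurableTypeR R)) : measurable A ->
    mu2.-integrable setT (EFin \o (fun p => f p * \1_A (sqn p))).
  move=> mA; apply: integrable_mul_bounded; first exact: (measurable_ind mA).
  by move=> p; exact: ind_le1.
have abs0 : \int[mu2]_p `|f p| = 0.
  transitivity (\int[mu2]_p (f p * \1_[set t | 0 < G t] (sqn p) -
                            f p * \1_[set t | 0 < - G t] (sqn p))).
    apply: eq_Rintegral => p _; rewrite !indicE !fG.
    have [Gp|Gn|G0] := ltgtP (G (sqn p)) 0.
    - rewrite memNset /=; last by apply/negP; rewrite -leNgt ltW.
      by rewrite mem_set /= ?oppr_gt0// mulr0 mulr1 add0r ltr0_norm.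
    - rewrite mem_set//= memNset /=; last by apply/negP; rewrite oppr_gt0 -leNgt ltW.
      by rewrite mulr0 mulr1 subr0 gtr0_norm.
    - by rewrite G0 !mul0r subr0 normr0.
  rewrite RintegralB//; [|exact: intA|exact: intA].
  by rewrite !integral_borel0// subrr.
have iabs := integrable_norm intf.
have E : (\int[mu2]_p `|(f p)%:E| = 0)%E.
  have fin := integrable_fin_num measurableT iabs.
  rewrite -(fineK fin) in abs0 *.
  by rewrite -[0%E]/((0 : R)%:E) -abs0.
have mEf : measurable_fun setT (EFin \o f) by exact/measurable_EFinP.
have := (@ae_eq_integral_abs _ _ _ mu2 setT measurableT _ mEf).1 E.
by apply: filterS => p /(_ I) [].
Qed.

End RadialLaplace.

Lemma moment0_real (h : plane -> C) (s : R) :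
  moment h 0 s%:C = cint mu2 (fun p => h p * (expR (- (s * sqn p)))%:C).
Proof.
congr cint; apply/funext => p; rewrite expr0 mulr1; congr (_ * _).
by rewrite -rmorphN -rmorphM cexp_real mulNr.
Qed.

Lemma laplace_unique (h k : plane -> C) (s0 : R) : s0 < 0 ->
  expdecay s0 h -> expdecay s0 k -> rot_invariant h -> rot_invariant k ->
  (forall s : R, 0 <= s -> moment h 0 s%:C = moment k 0 s%:C) ->
  {ae mu2, forall p, h p = k p}.
Proof.
move=> s00 dh dk rh rk E.
have int s l : 0 <= s -> expdecay s0 l ->
    cintegrable mu2 (fun p => l p * (expR (- (s * sqn p)))%:C).
  move=> s1 dl; have s2 : s0 < Re s%:C by exact: lt_le_trans s00 s1.
  have := cintegrable_moment 0 dl s2; congr cintegrable; apply/funext => p.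
  by rewrite expr0 mulr1 -rmorphN -rmorphM cexp_real mulNr.
have int0 l : expdecay s0 l -> cintegrable mu2 l.
  move=> /(int 0 _ (lexx 0)); congr cintegrable; apply/funext => p.
  by rewrite mul0r oppr0 expR0 mulr1.
have reE : {ae mu2, forall p, Re (h p) - Re (k p) = 0}.
  apply: radial_laplace_ae0.
  - have [hr _] := int0 _ dh; have [kr _] := int0 _ dk.
    by have := integrableB measurableT hr kr.
  - by move=> p p' pp'; rewrite (rh _ _ pp') (rk _ _ pp').
  - move=> s s1; have [hr _] := int s _ s1 dh; have [kr _] := int s _ s1 dk.
    have := E s s1; rewrite !moment0_real => -[Er _].
    transitivity (\int[mu2]_p (Re (h p * (expR (- (s * sqn p)))%:C) -
                              Re (k p * (expR (- (s * sqn p)))%:C))).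
      by apply: eq_Rintegral => p _; rewrite !Re_mulr_real mulrBl.
    by rewrite RintegralB// Er subrr.
have imE : {ae mu2, forall p, Im (h p) - Im (k p) = 0}.
  apply: radial_laplace_ae0.
  - have [_ hr] := int0 _ dh; have [_ kr] := int0 _ dk.
    by have := integrableB measurableT hr kr.
  - by move=> p p' pp'; rewrite (rh _ _ pp') (rk _ _ pp').
  - move=> s s1; have [_ hr] := int s _ s1 dh; have [_ kr] := int s _ s1 dk.
    have := E s s1; rewrite !moment0_real => -[_ Er].
    transitivity (\int[mu2]_p (Im (h p * (expR (- (s * sqn p)))%:C) -
                              Im (k p * (expR (- (s * sqn p)))%:C))).
      by apply: eq_Rintegral => p _; rewrite !Im_mulr_real mulrBl.
    by rewrite RintegralB// Er subrr.
apply: filterS2 reE imE => p /eqP + /eqP.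
by rewrite !subr_eq0 => /eqP r /eqP i; exact: complex_ext.
Qed.

Lemma symbol_unique (phi : C -> C) (c : C) : L2 phi -> radial phi ->
  1 / 2 < Re c -> moment_rec c (weighted phi) 0 -> eq_ae phi (gamma c).
Proof.
move=> L2phi rphi c2 H0.
have s00 : - (1 / 2) < 0 :> R by lra.
have := laplace_unique s00 (expdecay_weighted L2phi) (expdecay_weighted (L2_gamma c2))
  (rot_invariant_weighted rphi) (rot_invariant_weighted (@radial_gamma _ c)).
move=> H; have {}H : {ae mu2, forall p, weighted phi p = weighted (gamma c) p}.
  apply: H => s s0; have s2 : - (1 / 2) < Re s%:C by exact: lt_le_trans s00 s0.
  have H1 := moment_rec_propagate s00 (expdecay_weighted L2phi) s2 H0.
  have H2 := moment_rec_gamma c2 s2.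
  have cs0 : c + s%:C != 0.
    apply: contraTneq c2 => cs; rewrite -leNgt.
    have : Re (c + s%:C) = 0 by rewrite cs.
    rewrite Re_add /=; lra.
  by apply: (mulfI cs0); have := H1 0%N; have := H2 0%N => /= -> ->; rewrite !mul0r.
apply: filterS H => p; apply: mulIf.
by rewrite eq_complex /= negb_and gt_eqF// gauss_gt0.
Qed.

End Uniqueness.

(** * The product of two Toeplitz operators *)

Section Final.
Context {R : realType}.
Local Notation C := (complex R).

(** Each factor maps the span into itself, so that both steps take place in the
    natural domains. *)
Lemma toeplitz_product_span (a b : C) n (c : nat -> C) :
  1 / 2 < Re a -> 1 / 2 < Re b ->
  let psi := fun z => \sum_(k < n) c k * basis_u k z in
  let TaTb := op_comp (toeplitz (gamma a)) (toeplitz (gamma b)) in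
  op_dom TaTb psi /\
  forall z, op_fun TaTb psi z = \sum_(k < n) (c k * (a * b) ^- k) * basis_u k z.
Proof.
move=> a2 b2 psi TaTb; rewrite /TaTb /=.
have E := toeplitz_gamma_span c n b2; rewrite -/psi in E; rewrite E.
split.
  split; split.
  - exact: F2_span.
  - exact: L2_gamma_span.
  - exact: (F2_span (fun k => c k * b ^- k)).
  - exact: (L2_gamma_span (fun k => c k * b ^- k)).
move=> z; rewrite (toeplitz_gamma_span (fun k => c k * b ^- k) n a2).
by apply: eq_bigr => k _; congr (_ * _); rewrite exprMn invfM; ring.
Qed.

End Final.

Theorem mainTheorem9 (R : realType) (a b : complex R)
  (ha : 1 / 2 < complex.Re a) (hb : 1 / 2 < complex.Re b) :
  let TaTb := op_comp (toeplitz (gamma a)) (toeplitz (gamma b)) in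
  ((exists phi : complex R -> complex R, is_toeplitz_with_symbol TaTb phi)
     <-> 1 / 2 < complex.Re (a * b)) /\
  (1 / 2 < complex.Re (a * b) ->
     is_toeplitz_with_symbol TaTb (gamma (a * b)) /\
     forall phi : complex R -> complex R,
       is_toeplitz_with_symbol TaTb phi -> eq_ae phi (gamma (a * b))).
Proof.
move=> TaTb.
have ab0 : a * b != 0.
  by rewrite mulf_neq0//; [apply: contraTneq ha|apply: contraTneq hb] => ->; rewrite -leNgt /=; lra.
have sym phi : is_toeplitz_with_symbol TaTb phi ->
    [/\ L2 phi, radial phi & moment_rec (a * b) (weighted phi) 0].
  move=> [[mphi rphi dphi] E].
  (* The function [u_0 = 1] gives the square integrability of [phi]. *)
  have L2phi : L2 phi.
    have [_ /=] := dphi 0%N; congr L2; apply/funext => w.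
    by rewrite /basis_u expr0 fact0 sqrtr1 divr1 mulr1.
  split => //; apply: rec_of_moment => // n.
  pose c k : complex R := if k == n then 1 else 0.
  (* The eigenvalue is read off at [z = 1], where [u_n] does not vanish. *)
  have [_ _ /(_ 1)] := E _ (ex_intro _ n.+1 (ex_intro _ c erefl)).
  rewrite (toeplitz_product_span n.+1 c ha hb).2 /=.
  have -> : (fun w => phi w * \sum_(k < n.+1) c k * basis_u k w) =
      (fun w => phi w * basis_u n w).
    by apply/funext => w; rewrite basis_u_span.
  rewrite bargmann_radial// big_ord_recr /= big1 => [|k _]; last first.
    by rewrite /c ltn_eqF// !mul0r.
  rewrite add0r /c eqxx mul1r => H.
  have u0 : basis_u n (1 : complex R) != 0.
    by rewrite /basis_u expr1n mul1r invr_eq0 fmorph_eq0 gt_eqF.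
  by rewrite (mulIf u0 H) mulrC divfK// natr_fact_neq0.
have pos : 1 / 2 < complex.Re (a * b) -> is_toeplitz_with_symbol TaTb (gamma (a * b)).
  move=> ab2; split.
    split; [exact: cmeasurable_gamma|exact: radial_gamma|move=> n].
    pose d k : complex R := if k == n then 1 else 0.
    rewrite basis_u_span; split; first exact: (F2_span d n.+1).
    exact: (L2_gamma_span d n.+1 ab2).
  move=> psi [n [c ->]]; have [dom val] := toeplitz_product_span n c ha hb.
  split; [exact: dom| |move=> z].
    by split; [exact: F2_span|exact: L2_gamma_span].
  by rewrite val /= toeplitz_gamma_span.
split; last first.
  move=> ab2; split; first exact: pos.
  by move=> phi /sym[L2phi rphi rec]; exact: symbol_unique.
split; last by move=> /pos ?; exists (gamma (a * b)).
by move=> [phi /sym[L2phi _ rec]]; exact: Re_gt_half rec.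
Qed.
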